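(* Let $Y$ be a finite graph with an edge-free action of a finite group $G$, let $\mathbb{X}=Y/\!\!/G=(X,X_v)$ be the quotient graph of groups, and let $\rho$ be a representation of $G$ of degree $d$. Let $n=\#V(X)$, let $m$ be the number of edges of $X$, and let $b_1(X)=m-n+1$. Let $A_\rho$, $Q_\rho$, $C_\rho$ be the $nd\times nd$ matrices, written in $d\times d$ blocks indexed by $V(X)\times V(X)$, given by $$(A_\rho)_{uv}=\sum_{h\in H(X):\ r(h)=u,\ r(\overline h)=v}\rho(F(h)),\qquad (Q_\rho)_{uv}=\delta_{uv}\,\mathrm{val}(v)\,I_d,\qquad (C_\rho)_{uv}=\delta_{uv}\sum_{g\in X_v}\rho(g),$$ and let $l_{\rho,+}$ and $l_{\rho,-}$ be respectively the total number of $+1$ and $-1$ eigenvalues (with multiplicity) of all the matrices $\rho(F(l))$, $l\in L(X)$. Then the $L$-function of $Y/\mathbb{X}$ evaluated at $\rho$ satisfies $$L(u,\rho,Y/\mathbb{X})^{-1}=(1-u^2)^{(b_1(X)-1)d}(1+u)^{l_{\rho,+}}(1-u)^{l_{\rho,-}}\det\bigl(I_{nd}-C_\rho A_\rho u+(C_\rho Q_\rho-I_{nd})u^2\bigr).$$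
   Context: Graphs. A graph (with legs) $X$ consists of vertices $V(X)$, half-edges $H(X)$, a root map $r:H(X)\to V(X)$, and an involution $h\mapsto\overline h$ on $H(X)$. The valency of $v$ is $\mathrm{val}(v)=\#(r^{-1}(v))$. Orbits $\{h,\overline h\}$ of size 2 are edges; half-edges with $\overline h=h$ are legs, forming the set $L(X)$. All graphs are connected. A path of length $n\ge1$ in $X$ is a sequence $h_1\cdots h_n$ of half-edges with $r(h_{j+1})=r(\overline{h_j})$ for $1\le j\le n-1$; it is closed if $r(\overline{h_n})=r(h_1)$. Graphs of groups. An edge-trivial graph of groups $\mathbb{X}=(X,X_v)$ is a graph $X$ with a group $X_v$ for each $v\in V(X)$. A path of length $n\ge1$ in $\mathbb{X}$ is $g_0h_1g_1h_2\cdots g_{n-1}h_n$ where $h_1\cdots h_n$ is a path in $X$, $g_0\in X_{r(h_1)}$ and $g_j\in X_{r(\overline{h_j})}$ for $1\le j\le n-1$. It is closed if $h_1\cdots h_n$ is closed; a closed path is reduced if for each $j\in\{1,\dots,n\}$ (indices mod $n$) either $h_{j+1}\ne\overline{h_j}$ or $g_j\ne1$. A closed reduced path is primitive if it is not a power $R^k$, $k\ge2$, of a path. Closed paths of the same length are equivalent if they differ by a simultaneous cyclic shift of the $g_{j-1}$ and $h_j$. A prime of $\mathbb{X}$ is an equivalence class of primitive paths. $\ell(Q)$ denotes the length of a path $Q$. Quotients. A $G$-action on $Y$ (by bijections of $V(Y)$ and $H(Y)$ commuting with $r$ and the involution) is edge-free if $G$ acts freely on $H(Y)$. The quotient graph $X=Y/G$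 has $V(X)=V(Y)/G$, $H(X)=H(Y)/G$, with induced root map and involution; $\pi:Y\to X$ is the projection. Choose a spanning tree $T_X\subset X$ and a connected lift $T\subset Y$ of it; for $v\in V(X)$ let $v^T$ be its lift to $T$. The graph of groups $\mathbb{X}=Y/\!\!/G$ has underlying graph $X$ and $X_v=$ stabilizer of $v^T$ in $G$. For each $h\in H(X)$ choose $h^S\in H(Y)$ above $h$ and $F(h)\in G$ as follows. If $h\in H(T_X)$, $h^S$ is its lift to $T$ and $F(h)=1$. For each edge of $X$ not in $T_X$ choose an orientation $(h,\overline h)$ and let $v=r(\overline h)$; choose $h^S$ above $h$ rooted at $r(h)^T$, choose $F(h)\in G$ with $F(h)(v^T)=r(\overline{h^S})$, and set $F(\overline h)=F(h)^{-1}$, $(\overline h)^S=F(\overline h)(\overline{h^S})$. For a leg $l$ of $X$ whose preimages are legs of $Y$, choose a leg $l^S$ above $l$ rooted at $r(l)^T$ and set $F(l)=1$. For a leg $l$ of $X$ whose preimages belong to edges of $Y$, choose an edge $\{h,\overline h\}$ of $Y$ with $\pi(h)=l$, $r(h)=r(l)^T$, set $l^S=h$, and let $F(l)$ be the unique (order 2) element of $G$ sending $h$ to $\overline h$. All these choices are fixed. Since $F(l)^2=1$ for every leg $l$, each $\rho(F(l))$ is diagonalizable with eigenvalues $\pm1$. The Frobenius element of a path $Q=g_0h_1g_1\cdots g_{n-1}h_n$ in $\mathbb{X}$ is $F(Q)=g_0F(h_1)g_1F(h_2)\cdots g_{n-1}F(h_n)\in G$. Representations are finite-dimensional and complex. The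 Artin–Ihara $L$-function is $$L(u,\rho,Y/\mathbb{X})=\prod_{\mathfrak q}\det\bigl(I_d-\rho(F(Q))u^{\ell(Q)}\bigr)^{-1},$$ the product over all primes $\mathfrak q$ of $\mathbb{X}$, where $Q$ is an arbitrary representative of $\mathfrak q$ (different representatives have conjugate Frobenius elements); it converges for sufficiently small complex $u$. *)

(* Defs.v *)
From HB Require Import structures.
From mathcomp Require Import all_boot all_order all_algebra all_fingroup.
From mathcomp Require Import all_character finmap complex.
From mathcomp Require Import boolp classical_sets reals topology normedtype.
From mathcomp Require Import summability.

Set Implicit Arguments.
Unset Strict Implicit.
Unset Printing Implicit Defensive.

Import Order.TTheory GRing.Theory Num.Theory.
Import numFieldNormedType.Exports.

Local Open Scope ring_scope.

(* R[i], packaged so that the topology of numFieldTypes is inferred on it. *)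
Definition Cplx (R : realType) : numClosedFieldType := R[i].

Record graph := Graph {
  vertex : finType;
  half_edge : finType;
  root : half_edge -> vertex;
  bar : half_edge -> half_edge;
  barK : involutive bar
}.

Definition is_leg (X : graph) (h : half_edge X) : bool := bar h == h.

Definition valency (X : graph) (v : vertex X) : nat :=
  #|[pred h : half_edge X | root h == v]|.

Definition edges (X : graph) : {set {set half_edge X}} :=
  [set [set h; bar h]%SET | h : half_edge X & ~~ is_leg h]%SET.

(* An integer: the exponent betti1 - 1 is -1 when X is a tree. *)
Definition betti1 (X : graph) : int :=
  #|edges X|%:Z - #|vertex X|%:Z + 1.

Definition adjacent_in (X : graph) (T : {set half_edge X}) : rel (vertex X) :=
  fun u v => [exists h in T, (root h == u) && (root (bar h) == v)].

Definition connected_by (X : graph) (T : {set half_edge X}) : Prop :=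
  (0 < #|vertex X|)%N /\ forall u v, connect (adjacent_in T) u v.

Definition connected_graph (X : graph) : Prop :=
  connected_by [set: half_edge X]%SET.

Definition closed_path (X : graph) (p : seq (half_edge X)) : bool :=
  (p != [::]) && path.cycle (fun h k => root k == root (bar h)) p.

Definition reduced_cycle (X : graph) (p : seq (half_edge X)) : bool :=
  path.cycle (fun h k => k != bar h) p.

(* A spanning tree contains every vertex, so it is given by its half-edges. *)
Definition spanning_tree (X : graph) (T : {set half_edge X}) : Prop :=
  [/\ forall h, h \in T -> bar h \in T,
      forall h, h \in T -> ~~ is_leg h,
      connected_by T
    & forall p, closed_path p -> all (mem T) p -> ~~ reduced_cycle p].

(* MathComp actions are right actions; the left action is g . x := x g^-1. *)
Definition lact (gT : finGroupType) (T : finType) (to : {action gT &-> T})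
  (g : gT) (x : T) : T := to x g^-1%g.

Record graph_action (gT : finGroupType) (Y : graph) := GraphAction {
  actV : {action gT &-> vertex Y};
  actH : {action gT &-> half_edge Y};
  root_lact : forall g h, root (lact actH g h) = lact actV g (root h);
  bar_lact : forall g h, bar (lact actH g h) = lact actH g (bar h)
}.

Arguments root_lact {gT Y} _ _ _.
Arguments bar_lact {gT Y} _ _ _.

Definition edge_free (gT : finGroupType) (Y : graph)
    (a : graph_action gT Y) : Prop :=
  forall g h, lact (actH a) g h = h -> g = 1%g.

Definition orbits (gT : finGroupType) (T : finType) (to : {action gT &-> T}) :
  {set {set T}} := [set orbit to [set: gT]%SET x | x : T]%SET.

Definition quot (gT : finGroupType) (T : finType) (to : {action gT &-> T}) :
  finType := {A : {set T} | A \in orbits to}.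

Definition proj (gT : finGroupType) (T : finType) (to : {action gT &-> T})
    (x : T) : quot to :=
  exist _ (orbit to [set: gT]%SET x) (imset_f (orbit to [set: gT]%SET) isT).

Lemma imset_orbit (gT : finGroupType) (T U : finType)
    (toT : {action gT &-> T}) (toU : {action gT &-> U}) (f : T -> U)
    (fE : forall g x, f (lact toT g x) = lact toU g (f x)) (x : T) :
  (f @: orbit toT [set: gT] x)%SET = orbit toU [set: gT]%SET (f x).
Proof.
have fE' g y : f (toT y g) = toU (f y) g.
  by have := fE g^-1%g y; rewrite /lact invgK.
apply/setP => y; apply/imsetP/orbitP => [[_ /orbitP[g _ <-] ->]|[g _ <-]].
  by exists g => //; rewrite fE'.
by exists (toT x g); rewrite ?fE' // mem_orbit.
Qed.

Lemma imset_orbits (gT : finGroupType) (T U : finType)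
    (toT : {action gT &-> T}) (toU : {action gT &-> U}) (f : T -> U)
    (fE : forall g x, f (lact toT g x) = lact toU g (f x)) (A : {set T}) :
  A \in orbits toT -> (f @: A)%SET \in orbits toU.
Proof. by case/imsetP => x _ ->; rewrite (imset_orbit fE) imset_f. Qed.

(* The map of orbits induced by an equivariant map: the image of an orbit. *)
Definition quot_map (gT : finGroupType) (T U : finType)
    (toT : {action gT &-> T}) (toU : {action gT &-> U}) (f : T -> U)
    (fE : forall g x, f (lact toT g x) = lact toU g (f x))
    (A : quot toT) : quot toU :=
  exist _ (f @: val A)%SET (imset_orbits fE (valP A)).

Lemma quot_map_proj (gT : finGroupType) (T U : finType)
    (toT : {action gT &-> T}) (toU : {action gT &-> U}) (f : T -> U)
    (fE : forall g x, f (lact toT g x) = lact toU g (f x)) (x : T) :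
  quot_map fE (proj toT x) = proj toU (f x).
Proof. by apply: val_inj; rewrite /= (imset_orbit fE). Qed.

Lemma quot_bar_subproof (gT : finGroupType) (Y : graph)
    (a : graph_action gT Y) : involutive (quot_map (bar_lact a)).
Proof.
move=> A; apply: val_inj; rewrite /= -imset_comp.
by under eq_imset => h do rewrite /= barK; rewrite imset_id.
Qed.

Definition quotient_graph (gT : finGroupType) (Y : graph)
    (a : graph_action gT Y) : graph :=
  @Graph (quot (actV a)) (quot (actH a)) (quot_map (root_lact a))
    (quot_map (bar_lact a)) (@quot_bar_subproof _ _ a).

(* The choices entering the quotient graph of groups Y//G. The connected lift
   of the spanning tree has vertices [vlift v] and half-edges [hlift h],
   h \in tree; [hlift] is h |-> h^S and [frob] is h |-> F(h). *)
Record lift_data (gT : finGroupType) (Y : graph) (a : graph_action gT Y) :=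
  LiftData {
  tree : {set half_edge (quotient_graph a)};
  orientation : {set half_edge (quotient_graph a)};
  vlift : vertex (quotient_graph a) -> vertex Y;
  hlift : half_edge (quotient_graph a) -> half_edge Y;
  frob : half_edge (quotient_graph a) -> gT;
  tree_spanning : spanning_tree tree;
  vliftK : cancel vlift (proj (actV a));
  hliftK : cancel hlift (proj (actH a));
  lift_tree : forall h, h \in tree ->
    [/\ root (hlift h) = vlift (root h),
        bar (hlift h) = hlift (bar h)
      & frob h = 1%g];
  orientationP : forall h, ~~ is_leg h -> h \notin tree ->
    (h \in orientation) = (bar h \notin orientation);
  lift_edge : forall h, ~~ is_leg h -> h \notin tree -> h \in orientation ->
    [/\ root (hlift h) = vlift (root h),
        lact (actV a) (frob h) (vlift (root (bar h))) = root (bar (hlift h)),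
        frob (bar h) = (frob h)^-1%g
      & hlift (bar h) = lact (actH a) (frob (bar h)) (bar (hlift h))];
  lift_leg_leg : forall l, is_leg l -> is_leg (hlift l) ->
    root (hlift l) = vlift (root l) /\ frob l = 1%g;
  lift_leg_edge : forall l, is_leg l -> ~~ is_leg (hlift l) ->
    root (hlift l) = vlift (root l) /\
    lact (actH a) (frob l) (hlift l) = bar (hlift l)
}.

(* The vertex groups are subgroups of one ambient finite group. *)
Record graph_of_groups (gT : finGroupType) := GraphOfGroups {
  underlying : graph;
  vgroup : vertex underlying -> {group gT}
}.

Definition quotient_gog (gT : finGroupType) (Y : graph)
    (a : graph_action gT Y) (c : lift_data a) : graph_of_groups gT :=
  @GraphOfGroups gT (quotient_graph a) (fun v => 'C[vlift c v | actV a]%G).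

(* The path g_0 h_1 g_1 h_2 ... g_(n-1) h_n is encoded as the sequence of
   pairs (g_0, h_1), ..., (g_(n-1), h_n). *)
Definition word (gT : finGroupType) (X : graph_of_groups gT) : Type :=
  seq (gT * half_edge (underlying X)).

Definition gog_step (gT : finGroupType) (X : graph_of_groups gT) :
    rel (gT * half_edge (underlying X)) :=
  fun x y => (root y.2 == root (bar x.2)) &&
             (y.1 \in vgroup (root (bar x.2))).

Definition gog_path (gT : finGroupType) (X : graph_of_groups gT)
    (Q : word X) : bool :=
  if Q is x :: Q' then
    (x.1 \in vgroup (root x.2)) && path (@gog_step gT X) x Q'
  else false.

Definition gog_closed (gT : finGroupType) (X : graph_of_groups gT)
    (Q : word X) : bool :=
  gog_path Q &&
  (if Q is x :: Q' then root (bar (last x Q').2) == root x.2 else false).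

(* [cycle] compares each pair (g_(j-1), h_j) with its successor (g_j, h_(j+1)),
   the indices being taken modulo the length. *)
Definition gog_reduced (gT : finGroupType) (X : graph_of_groups gT)
    (Q : word X) : bool :=
  gog_closed Q && path.cycle (fun x y => (y.2 != bar x.2) || (y.1 != 1%g)) Q.

Definition gog_primitive (gT : finGroupType) (X : graph_of_groups gT)
    (Q : word X) : Prop :=
  gog_reduced Q /\
  forall (P : word X) (k : nat),
    gog_path P -> (2 <= k)%N -> Q <> flatten (nseq k P).

Definition cyclic_shift (T : Type) (P Q : seq T) : Prop :=
  exists i, Q = rot i P.

Definition cyclic_class (gT : finGroupType) (X : graph_of_groups gT)
    (Q : word X) : set (word X) :=
  [set P | gog_closed P /\ cyclic_shift Q P]%classic.

Definition primes (gT : finGroupType) (X : graph_of_groups gT) :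
    set (set (word X)) :=
  [set q | exists2 Q, gog_primitive Q & q = cyclic_class Q]%classic.

Definition frobenius (gT : finGroupType) (X : graph_of_groups gT)
    (F : half_edge (underlying X) -> gT) (Q : word X) : gT :=
  (\prod_(x <- Q) (x.1 * F x.2))%g.

Definition path_factor (R : realType) (gT : finGroupType) (d : nat)
    (rho : mx_representation (Cplx R) [set: gT]%SET d)
    (X : graph_of_groups gT) (F : half_edge (underlying X) -> gT)
    (u : Cplx R) (Q : word X) : Cplx R :=
  \det (1%:M - u ^+ size Q *: rho (frobenius F Q)).

Lemma cyclic_shift_factor (R : realType) (gT : finGroupType) (d : nat)
    (rho : mx_representation (Cplx R) [set: gT]%SET d)
    (X : graph_of_groups gT) (F : half_edge (underlying X) -> gT)
    (u : Cplx R) (Q P : word X) :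
  cyclic_shift Q P -> path_factor rho F u P = path_factor rho F u Q.
Proof.
case=> i ->; rewrite /path_factor size_rot /frobenius /rot big_cat /=.
set s := u ^+ _; rewrite -[in RHS](cat_take_drop i Q) big_cat /=.
set g := bigop _ (take i Q) _; set h := bigop _ (drop i Q) _.
have rU x : rho x \in unitmx by apply: repr_mx_unit; rewrite inE.
have -> : 1%:M - s *: rho (h * g)%g =
          invmx (rho g) *m (1%:M - s *: rho (g * h)%g) *m rho g.
  rewrite !repr_mxM ?inE // mulmxBr mulmxBl mulmx1 mulVmx //.
  by rewrite -scalemxAr -scalemxAl -!mulmxA mulKmx.
by rewrite !det_mulmx mulrAC -det_mulmx mulVmx // det1 mul1r.
Qed.

(* By [prime_factorE] the representative picked by [xget] is immaterial. *)
Definition prime_factor (R : realType) (gT : finGroupType) (d : nat)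
    (rho : mx_representation (Cplx R) [set: gT]%SET d)
    (X : graph_of_groups gT) (F : half_edge (underlying X) -> gT)
    (u : Cplx R) (q : set (word X)) : Cplx R :=
  path_factor rho F u (xget [::] q).

Lemma prime_factorE (R : realType) (gT : finGroupType) (d : nat)
    (rho : mx_representation (Cplx R) [set: gT]%SET d)
    (X : graph_of_groups gT) (F : half_edge (underlying X) -> gT)
    (u : Cplx R) (q : set (word X)) (Q : word X) :
  primes q -> q Q -> prime_factor rho F u q = path_factor rho F u Q.
Proof.
case=> P _ -> qQ; rewrite /prime_factor.
have [_ /cyclic_shift_factor ->] := xgetI [::] qQ.
by case: qQ => _ /cyclic_shift_factor ->.
Qed.

(* The product over a finite set of primes; [totally] is the filter of
   eventually large finite sets, so that the convergence of the Euler product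
   does not depend on an enumeration of the primes. *)
Definition euler_product (R : realType) (gT : finGroupType) (d : nat)
    (rho : mx_representation (Cplx R) [set: gT]%SET d)
    (X : graph_of_groups gT) (F : half_edge (underlying X) -> gT)
    (u : Cplx R) (A : {fset set_type (@primes gT X)}) : Cplx R :=
  \prod_(q <- A) (prime_factor rho F u (val q))^-1.

Definition L_converges (R : realType) (gT : finGroupType) (d : nat)
    (rho : mx_representation (Cplx R) [set: gT]%SET d)
    (Y : graph) (a : graph_action gT Y) (c : lift_data a)
    (u : Cplx R) : Prop :=
  cvg (euler_product rho (X := quotient_gog c) (frob c) u @ totally)%classic.

Definition L_function (R : realType) (gT : finGroupType) (d : nat)
    (rho : mx_representation (Cplx R) [set: gT]%SET d)
    (Y : graph) (a : graph_action gT Y) (c : lift_data a)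
    (u : Cplx R) : Cplx R :=
  lim (euler_product rho (X := quotient_gog c) (frob c) u @ totally)%classic.

(* nd x nd matrix (n = #V(X)) with given d x d blocks indexed by V(X). *)
Definition vblock_mx (K : fieldType) (X : graph) (d : nat)
    (B : vertex X -> vertex X -> 'M[K]_d) :
    'M[K]_(\sum_(i < #|vertex X|) d) :=
  \mxblock_(i < #|vertex X|, j < #|vertex X|) B (enum_val i) (enum_val j).

Definition A_mx (R : realType) (gT : finGroupType) (d : nat)
    (rho : mx_representation (Cplx R) [set: gT]%SET d)
    (Y : graph) (a : graph_action gT Y) (c : lift_data a) :=
  vblock_mx (fun u v : vertex (quotient_graph a) =>
    \sum_(h : half_edge (quotient_graph a) | (root h == u) && (root (bar h) == v))
       rho (frob c h)).

Definition Q_mx (R : realType) (gT : finGroupType) (d : nat)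
    (Y : graph) (a : graph_action gT Y) :=
  vblock_mx (fun u v : vertex (quotient_graph a) =>
    if u == v then ((valency v)%:R : Cplx R)%:M else 0 : 'M[Cplx R]_d).

Definition C_mx (R : realType) (gT : finGroupType) (d : nat)
    (rho : mx_representation (Cplx R) [set: gT]%SET d)
    (Y : graph) (a : graph_action gT Y) (c : lift_data a) :=
  vblock_mx (fun u v : vertex (quotient_graph a) =>
    if u == v then \sum_(g in vgroup (g := quotient_gog c) v) rho g else 0).

(* Total algebraic multiplicity of the eigenvalue e of the matrices
   rho(F(l)), l a leg; the numbers l_(rho,+) and l_(rho,-) are e = 1, -1. *)
Definition leg_mult (R : realType) (gT : finGroupType) (d : nat)
    (rho : mx_representation (Cplx R) [set: gT]%SET d)
    (Y : graph) (a : graph_action gT Y) (c : lift_data a)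
    (e : Cplx R) : nat :=
  \sum_(l : half_edge (quotient_graph a) | is_leg l)
     mup e (char_poly (rho (frob c l))).

(* Main.v *)
Require Import Defs.
From mathcomp Require Import all_boot all_order all_algebra all_fingroup.
From mathcomp Require Import all_character.
From mathcomp Require Import cyclic spectral finmap complex zify ring.
From mathcomp Require Import boolp classical_sets reals topology normedtype.
From mathcomp Require Import summability.
Import Order.TTheory GRing.Theory Num.Theory.
Import numFieldNormedType.Exports.
Local Open Scope ring_scope.

(** The closed reduced paths are the closed walks on the letters [(g, h)], so
    the Euler product should be [det (1 - u N)], with [N] the [rho]-weighted
    transfer matrix of this walk. Indeed, every closed walk is uniquely a power
    of a primitive one and a primitive class of length [l] has [l] members, so
    that the trace of [N ^ k] equals the sum of the contributions of the primes
    of length dividing [k]: a product over finitely many primes, including all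
    those of length at most [n], has the same logarithmic derivative as
    [det (1 - u N)] up to order [n], hence the same coefficients. A uniform
    majorant of the coefficients turns this into convergence for small [u].

    Eliminating the group elements, [det (1 - u N) = det (1 - u (S T - J))] on
    half-edges, where [J] is the [F]-twisted version of [h |-> bar h]. Since
    [J ^ 2 = 1], factoring out [1 + u J] leaves a determinant on vertices with
    [T S = C A] and [T J S = C Q]; and [det (1 + u J)] is determined by the size
    of [J] and by its trace, to which only the legs contribute. *)

Set Implicit Arguments.
Unset Strict Implicit.
Unset Printing Implicit Defensive.

(** * Eigenvalues and determinants *)

Lemma trig_mulmx (K : comPzRingType) n (A B : 'M[K]_n) :
  is_trig_mx A -> is_trig_mx B ->
  is_trig_mx (A *m B) /\ forall i, (A *m B) i i = A i i * B i i.
Proof.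
move=> /is_trig_mxP tA /is_trig_mxP tB; split=> [|i].
  apply/is_trig_mxP => i j ltij; rewrite mxE big1 // => k _.
  have [ltik|leki] := ltnP i k; first by rewrite tA ?mul0r.
  by rewrite tB ?mulr0 // (leq_ltn_trans leki).
rewrite mxE (bigD1 i) //= big1 ?addr0 // => k.
rewrite neq_ltn => /orP[ltki|ltik]; first by rewrite tB ?mulr0.
by rewrite tA ?mul0r.
Qed.

Lemma trig_expmx (K : comPzRingType) n (A : 'M[K]_n) k :
  is_trig_mx A -> is_trig_mx (A ^+ k) /\ forall i, (A ^+ k) i i = A i i ^+ k.
Proof.
move=> tA; elim: k => [|k [tAk Ak]]; first last.
  have [tAS AS] := trig_mulmx tA tAk.
  by rewrite exprS; split=> // i; rewrite AS Ak -exprS.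
split=> [|i]; first exact: scalar_mx_is_trig.
by rewrite !expr0 mxE eqxx.
Qed.

(** A single list of eigenvalues, with multiplicity, serves all later uses at once. The last clause
    is what makes the eigenvalues of [rho g] roots of unity. *)
Definition eigen_seq_of (C : numClosedFieldType) n (M : 'M[C]_n) (s : seq C) :
    Prop :=
  [/\ size s = n, char_poly M = \prod_(z <- s) ('X - z%:P),
      forall k, \tr (M ^+ k) = \sum_(z <- s) z ^+ k,
      forall u, \det (1%:M - u *: M) = \prod_(z <- s) (1 - z * u)
    & forall k, M ^+ k = 1 -> forall z, z \in s -> z ^+ k = 1].

(** By Schur, a matrix of positive size is conjugate to a triangular one; the list is its
    diagonal. *)
Lemma eigen_seq_exists (C : numClosedFieldType) n (M : 'M[C]_n) :
  exists s, eigen_seq_of M s.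
Proof.
case: n M => [|n] M.
  exists [::]; split=> //.
  - by rewrite big_nil /char_poly det_mx00.
  - by move=> k; rewrite big_nil /mxtrace big_ord0.
  - by move=> u; rewrite big_nil det_mx00.
have [P /unitarymx_unit Pu] := Schur M (ltn0Sn n).
rewrite /similar_to /= conjumx // => tT.
have [T [{}tT MT]] : exists T : 'M_n.+1, is_trig_mx T /\ M = invmx P *m T *m P.
  by exists (P *m M *m invmx P); rewrite !mulmxA mulVmx // mul1mx mulmxKV.
have MTk k : M ^+ k = invmx P *m T ^+ k *m P.
  elim: k => [|k IHk]; first by rewrite !expr0 mulmx1 mulVmx.
  rewrite !exprS IHk -!mulmxE !mulmxA; congr (_ *m _ *m _).
  by rewrite {1}MT mulmxK.
have detP (Q : 'M_n.+1) : \det (invmx P *m Q *m P) = \det Q.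
  by rewrite !det_mulmx mulrAC -det_mulmx mulVmx // det1 mul1r.
exists [seq T i i | i <- enum 'I_n.+1]; split.
- by rewrite size_map size_enum_ord.
- rewrite big_map big_enum /= -char_poly_trig // /char_poly /char_poly_mx.
  have PX : map_mx polyC (invmx P) *m map_mx polyC P = 1%:M.
    by rewrite -map_mxM mulVmx // map_mx1.
  rewrite [in LHS]MT !map_mxM.
  have XE : 'X%:M = map_mx polyC (invmx P) *m 'X%:M *m map_mx polyC P :> 'M_n.+1.
    by rewrite scalar_mxC -mulmxA PX mulmx1.
  rewrite [in LHS]XE -mulmxBl -mulmxBr !det_mulmx mulrAC -det_mulmx PX det1.
  by rewrite mul1r.
- move=> k; rewrite MTk -mulmxA mxtrace_mulC mulmxK // big_map big_enum /=.
  by apply: eq_bigr => i _; have [_ ->] := trig_expmx k tT.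
- move=> u; rewrite big_map big_enum /=.
  have -> : 1%:M - u *: M = invmx P *m (1%:M - u *: T) *m P.
    by rewrite mulmxBr mulmxBl mulmx1 mulVmx // -scalemxAr -scalemxAl -MT.
  rewrite detP det_trig; last first.
    apply/is_trig_mxP => i j ltij; have /is_trig_mxP/(_ _ _ ltij) Tij := tT.
    by rewrite !mxE Tij mulr0 subr0 -val_eqE ltn_eqF.
  by apply: eq_bigr => i _; rewrite !mxE eqxx mulrC.
move=> k Mk1 _ /mapP[i _ ->].
have [_ <-] := trig_expmx k tT.
suff -> : T ^+ k = 1 by rewrite mxE eqxx.
have := MTk k; rewrite Mk1 => /(congr1 (fun Q => P *m Q *m invmx P)).
by rewrite !mulmxA mulmxV // mul1mx mulmxK // mulmx1 mulmxV.
Qed.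

(** Both sides are the determinant of the block matrix with rows [1, A] and [B, 1], factored once as
    lower times upper triangular and once as upper times lower. *)
Lemma det_1B_mulC (K : comPzRingType) m n (A : 'M[K]_(m, n)) (B : 'M[K]_(n, m)) :
  \det (1%:M - A *m B) = \det (1%:M - B *m A).
Proof.
have <- : \det (block_mx 1%:M A B 1%:M) = \det (1%:M - B *m A).
  rewrite -[block_mx _ _ _ _]mul1mx.
  have -> : block_mx 1%:M A B 1%:M =
            block_mx 1%:M 0 B 1%:M *m block_mx 1%:M A 0 (1%:M - B *m A).
    by rewrite mulmx_block !mul1mx !mul0mx !mulmx1 !addr0 addrC subrK.
  by rewrite mul1mx det_mulmx det_lblock det_ublock !det1 !mul1r.
have -> : block_mx 1%:M A B 1%:M =
          block_mx 1%:M A 0 1%:M *m block_mx (1%:M - A *m B) 0 B 1%:M.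
  by rewrite mulmx_block !mul1mx !mul0mx !mulmx1 !add0r subrK.
by rewrite det_mulmx det_lblock det_ublock !det1 !mul1r mulr1.
Qed.

(** The eigenvalues square to 1, so each is 1 or -1 and everything reduces to counting them. *)
Lemma involution_eigenvalues (C : numClosedFieldType) n (M : 'M[C]_n)
    (p := mup 1 (char_poly M)) (q := mup (- 1) (char_poly M)) :
  M *m M = 1%:M ->
  [/\ (p + q = n)%N, \tr M = p%:R - q%:R
    & forall u, \det (1%:M + u *: M) = (1 + u) ^+ p * (1 - u) ^+ q].
Proof.
move=> M2; have [s [szs cpM trs dets idem]] := eigen_seq_exists M.
have s1 z : z \in s -> (z == 1) || (z == -1).
  by rewrite -sqrf_eq1 => /idem -> //; rewrite expr2 -mulmxE M2.
have neq1 : (1 == -1 :> C) = false.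
  by rewrite -addr_eq0 -(natrD _ 1 1) pnatr_eq0.
have trM : \tr M = \sum_(z <- s) z.
  by rewrite -[M in LHS]expr1 trs; apply: eq_bigr => z _; rewrite expr1.
rewrite /p /q cpM !mu_prod_XsubC trM.
suff [-> -> sE] : [/\ (count_mem 1%R s + count_mem (- 1)%R s = size s)%N,
    \sum_(z <- s) z = (count_mem 1 s)%:R - (count_mem (- 1) s)%:R
  & forall u, \prod_(z <- s) (1 - z * (- u)) =
      (1 + u) ^+ count_mem 1 s * (1 - u) ^+ count_mem (- 1) s].
  by split=> // u; rewrite -sE -dets scaleNr opprK.
elim: s s1 {p q szs cpM trs dets idem trM} => [|z s IHs] s1.
  by rewrite /= big_nil subr0; split=> // u; rewrite big_nil mulr1.
have [|IH1 IH2 IH3] := IHs.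
  by move=> y sy; apply: s1; rewrite inE sy orbT.
have /orP[/eqP ->|/eqP ->] := s1 z (mem_head _ _) => /=.
  rewrite eqxx neq1 add0n add1n addSn IH1 big_cons IH2 mulrS addrA.
  by split=> // u; rewrite big_cons IH3 mul1r opprK mulrA -exprS.
rewrite eqxx eq_sym neq1 add0n add1n addnS IH1 big_cons IH2.
rewrite [(count_mem _ s).+1%:R]mulrS opprD addrCA.
by split=> // u; rewrite big_cons IH3 mulrNN mul1r mulrCA -exprS.
Qed.

(** Size and trace are the sum and the difference of the two multiplicities, hence determine
    both. *)
Lemma det_involution (C : numClosedFieldType) n (M : 'M[C]_n) (i j : nat) u :
  M *m M = 1%:M -> (i + j = n)%N -> \tr M = i%:R - j%:R ->
  \det (1%:M + u *: M) = (1 + u) ^+ i * (1 - u) ^+ j.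
Proof.
move=> /involution_eigenvalues[]; set p := mup 1 _; set q := mup (- 1) _.
move=> pq trE -> ijn; rewrite trE => /eqP.
rewrite subr_eq addrAC eq_sym subr_eq -!natrD eqr_nat => /eqP E.
by have [-> ->] : i = p /\ j = q by lia.
Qed.

(** As [J ^ 2 = 1], the inverse of [1 + u J] is [(1 - u J) / (1 - u ^ 2)]. Factoring [1 + u J] out
    leaves 1 minus a product through dimension [n], to which [det_1B_mulC] applies; the factor
    [(1 - u ^ 2) ^ n] clears the denominator. *)
Lemma det_walk_vertex (K : fieldType) m n (S : 'M[K]_(m, n)) (T : 'M[K]_(n, m))
    (J : 'M[K]_m) u : J *m J = 1%:M -> 1 - u ^+ 2 != 0 ->
  (1 - u ^+ 2) ^+ n * \det (1%:M - u *: (S *m T - J)) =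
  \det (1%:M + u *: J) *
  \det (1%:M - u *: (T *m S) + u ^+ 2 *: (T *m (J *m S) - 1%:M)).
Proof.
move=> J2 c_neq0; set c := 1 - u ^+ 2 in c_neq0 *.
pose B := c^-1 *: (1%:M - u *: J).
have JB : (1%:M + u *: J) *m B = 1%:M.
  rewrite -scalemxAr mulmxDl mul1mx mulmxBr mulmx1 -scalemxAl -scalemxAr J2.
  rewrite addrA subrK scalerA -expr2 -[X in X - _]scale1r -scalerBl.
  by rewrite scalerA mulVf // scale1r.
have -> : 1%:M - u *: (S *m T - J) =
    (1%:M + u *: J) *m (1%:M - (u *: (B *m S)) *m T).
  rewrite mulmxBr mulmx1 -scalemxAl -scalemxAr !mulmxA JB mul1mx.
  by rewrite scalerBr opprB addrA.
rewrite det_mulmx det_1B_mulC mulrCA -detZ; congr (_ * \det _).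
rewrite scalerBr -scalemxAr -!scalemxAl -scalemxAr mulmxBl mul1mx.
rewrite mulmxBr -!scalemxAl -!scalemxAr !scalerA mulrCA mulfV // mulr1.
rewrite scalerBr scalerA -expr2 opprB.
rewrite [c *: 1%:M]scalerBl scale1r [u ^+ 2 *: (_ - _)]scalerBr.
rewrite -!addrA; congr (_ + _).
rewrite addrCA [RHS]addrCA; congr (_ + _); exact: addrC.
Qed.

(** * Primitive words *)

Section Words.
Variable T : eqType.
Implicit Types (w P Q : seq T).

Definition word_pow k P := flatten (nseq k P).

Definition primitive_word w : Prop :=
  w != [::] /\ forall P k, (2 <= k)%N -> w <> word_pow k P.

Lemma word_powS k P : word_pow k.+1 P = P ++ word_pow k P.
Proof. by []. Qed.

Lemma size_word_pow k P : size (word_pow k P) = (k * size P)%N.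
Proof. by elim: k => // k IHk; rewrite word_powS size_cat IHk mulSn. Qed.

Lemma word_powM j k P : word_pow j (word_pow k P) = word_pow (j * k) P.
Proof.
elim: j => // j IHj; rewrite word_powS IHj mulSn.
by rewrite /word_pow nseqD flatten_cat.
Qed.

Lemma word_pow_rot1 k P : word_pow k (rot 1 P) = rot 1 (word_pow k P).
Proof.
case: P => [|x p].
  by have /size0nil -> : size (word_pow k ([::] : seq T)) = 0%N
    by rewrite size_word_pow muln0.
case: k => // k; rewrite [in RHS]word_powS cat_cons !rot1_cons.
elim: k => [|k IHk]; first by rewrite /word_pow /= !cats0.
by rewrite word_powS IHk word_powS cat_cons -!rcons_cat -cat_rcons.
Qed.

Lemma word_pow_inj k P Q :
  size P = size Q -> (0 < k)%N -> word_pow k P = word_pow k Q -> P = Q.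
Proof.
case: k => // k PQ _ /eqP; rewrite !word_powS eqseq_cat //.
by case/andP => /eqP.
Qed.

(** Shifts are treated as iterates of [rot 1], which compose additively for all exponents, whereas
    [rot n] is the identity once [n] exceeds the size. *)
Lemma iter_rot1_pow n k P :
  iter n (rot 1) (word_pow k P) = word_pow k (iter n (rot 1) P).
Proof. by elim: n => //= n ->; rewrite word_pow_rot1. Qed.

Lemma iter_rot1 n w : (n <= size w)%N -> iter n (rot 1) w = rot n w.
Proof.
elim: n => [|n IHn] ltnw; first by rewrite rot0.
by rewrite iterS IHn 1?ltnW // -rotS.
Qed.

Lemma iter_rot1_size w : iter (size w) (rot 1) w = w.
Proof. by rewrite iter_rot1 // rot_size. Qed.

Lemma iter_rot1_period n m w :
  iter n (rot 1) w = w -> iter (m * n) (rot 1) w = w.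
Proof. by move=> wn; elim: m => // m IHm; rewrite mulSn iterD IHm. Qed.

(** Write [w = A ++ B] with [A] of size [p]. Invariance says [B ++ A = A ++ B], so a nonempty [B]
    begins with [A] and is again invariant: induct on the number of blocks. *)
Lemma rot_period_pow p w : (0 < p)%N -> (p %| size w)%N -> rot p w = w ->
  w = word_pow (size w %/ p) (take p w).
Proof.
move=> p_gt0 /dvdnP[m szw] rotw; rewrite szw mulnK //.
elim: m w szw rotw => [|m IHm] w szw rotw.
  by rewrite (size0nil szw).
have p_le : (p <= size w)%N by rewrite szw leq_pmull.
set A := take p w; set B := drop p w.
have wAB : w = A ++ B by rewrite cat_take_drop.
have szA : size A = p by rewrite size_takel.
have szB : size B = (m * p)%N by rewrite size_drop szw mulSn addKn.
have BA : B ++ A = A ++ B by rewrite -wAB -[RHS]rotw.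
case: m IHm szB szw => [|m] IHm szB szw.
  by rewrite wAB (size0nil szB) /word_pow /= !cats0.
have tB : take p B = A.
  have := congr1 (take p) BA; rewrite takel_cat ?szB ?mulSn ?leq_addr //.
  by rewrite -{2}szA take_size_cat.
have B_eq : B = A ++ drop p B by rewrite -tB cat_take_drop.
have rB : rot p B = B.
  move: BA; rewrite {1}B_eq -catA => /eqP; rewrite eqseq_cat // eqxx /=.
  by rewrite /rot tB => /eqP.
by rewrite {1}wAB word_powS; congr (_ ++ _); rewrite {1}(IHm B szB rB) tB.
Qed.

(** The remainder of a period modulo the least positive one is again a period, so the least one
    divides all others, among them [size w]. *)
Lemma min_period w : w != [::] -> exists p,
  [/\ (0 < p)%N, w = word_pow (size w %/ p) (take p w), (p %| size w)%N
     & forall n, iter n (rot 1) w = w -> (p %| n)%N].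
Proof.
move=> w0; have sw0 : (0 < size w)%N by rewrite lt0n size_eq0.
have exw : exists p, (0 < p)%N && (iter p (rot 1) w == w).
  by exists (size w); rewrite sw0 iter_rot1_size eqxx.
case: (ex_minnP exw) => p /andP[p_gt0 /eqP pw] pmin.
have pdvd m : iter m (rot 1) w = w -> (p %| m)%N.
  rewrite {1}(divn_eq m p) addnC iterD (iter_rot1_period _ pw) => mw.
  rewrite /dvdn -leqn0 leqNgt; apply/negP => r_gt0.
  have := pmin (m %% p)%N; rewrite r_gt0 mw eqxx => /(_ isT).
  by rewrite leqNgt ltn_mod p_gt0.
have pdS := pdvd _ (iter_rot1_size w).
exists p; split=> //; apply: rot_period_pow => //.
by rewrite -iter_rot1 // dvdn_leq.
Qed.

(** A least period shorter than [P] would make [P] a proper power. Hence the [size P] shifts of [P]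
    are distinct. *)
Lemma primitive_word_period n P :
  primitive_word P -> iter n (rot 1) P = P -> (size P %| n)%N.
Proof.
move=> [P0 Pprim] nP; have [p [p_gt0 Pp pdS pmin]] := min_period P0.
have [lt1|le1] := ltnP 1 (size P %/ p)%N; first by case: (Pprim _ _ lt1 Pp).
suff -> : size P = p by exact: pmin.
apply/eqP; rewrite eqn_leq [X in _ && X]dvdn_leq ?lt0n ?size_eq0 // andbT.
by rewrite -{1}(divnK pdS) -[leqRHS]mul1n leq_mul.
Qed.

(** The root is the prefix whose length is the least period [p]. Were it a proper power of [Q], then
    [size Q] would be a smaller period. *)
Lemma primitive_root_exists w :
  w != [::] -> exists P k, [/\ primitive_word P, (0 < k)%N & w = word_pow k P].
Proof.
move=> w0; have [p [p_gt0 wp pdS pmin]] := min_period w0.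
have sw0 : (0 < size w)%N by rewrite lt0n size_eq0.
have szP : size (take p w) = p by rewrite size_takel // dvdn_leq.
exists (take p w), (size w %/ p)%N; split=> //; last by rewrite divn_gt0 // dvdn_leq.
split=> [|Q k k_ge2 PQ]; first by rewrite -size_eq0 szP -lt0n.
have pk : p = (k * size Q)%N by rewrite -szP PQ size_word_pow.
have /pmin : iter (size Q) (rot 1) w = w.
  rewrite wp PQ word_powM iter_rot1_pow; congr word_pow.
  exact: iter_rot1_size.
by move/dvdn_leq; nia.
Qed.

(** Shifting by [size Q] fixes the common power, hence fixes [P], so [size P] divides [size Q]. By
    symmetry the lengths agree, and both words are the same prefix. *)
Lemma primitive_root_unique i j P Q : primitive_word P -> primitive_word Q ->
  (0 < i)%N -> (0 < j)%N -> word_pow i P = word_pow j Q -> P = Q.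
Proof.
move=> pP pQ i_gt0 j_gt0 PQ.
have dvd k l A B : primitive_word A -> primitive_word B -> (0 < k)%N ->
    word_pow k A = word_pow l B -> (size A %| size B)%N.
  move=> pA pB k_gt0 AB; apply: primitive_word_period => //.
  apply: (word_pow_inj _ k_gt0); first by elim: (size B) => //= n; rewrite size_rot.
  by rewrite -iter_rot1_pow AB iter_rot1_pow iter_rot1_size.
have sPQ : size P = size Q.
  apply/eqP; rewrite eqn_dvd (dvd i j P Q) //.
  by rewrite (dvd j i Q P).
suff /(congr1 (take (size P))) : word_pow i P = word_pow j Q.
  case: i i_gt0 {PQ} => // i _; case: j j_gt0 => // j _.
  by rewrite !word_powS take_size_cat // sPQ take_size_cat.
exact: PQ.
Qed.

Lemma cycle_word_pow (e : rel T) k P :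
  (0 < k)%N -> path.cycle e (word_pow k P) = path.cycle e P.
Proof.
case: k => // k _; case: P => [|x p].
  by have /size0nil -> : size (word_pow k.+1 ([::] : seq T)) = 0%N
    by rewrite size_word_pow muln0.
rewrite word_powS /=; elim: k => [|k IHk]; first by rewrite /word_pow /= cats0.
rewrite word_powS cat_cons -cat_rcons rcons_cat cat_path last_rcons IHk.
by rewrite andbb.
Qed.

End Words.

Lemma iter_rot1K (T : eqType) n (w : seq T) :
  exists m, iter m (rot 1) (iter n (rot 1) w) = w.
Proof.
(* With the [n] shifts already made this totals [n * size w] when [w] is nonempty. *)
exists (n * (size w).-1)%N; rewrite -iterD.
case: w => [|x w]; first by elim: (n * _ + n)%N => //= m ->.
by rewrite addnC -mulnS; exact/iter_rot1_period/(iter_rot1_size (x :: w)).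
Qed.

Lemma cycle_iter_rot1 (T : eqType) (e : rel T) n w :
  path.cycle e (iter n (rot 1) w) = path.cycle e w.
Proof. by elim: n => //= n <-; rewrite rot_cycle. Qed.

Lemma size_iter_rot1 (T : eqType) n (w : seq T) :
  size (iter n (rot 1) w) = size w.
Proof. by elim: n => //= n <-; rewrite size_rot. Qed.

Lemma primitive_iter_rot1 (T : eqType) n (w : seq T) :
  primitive_word w -> primitive_word (iter n (rot 1) w).
Proof.
move=> [w0 wprim]; split=> [|P k k2 wP].
  by rewrite -size_eq0 size_iter_rot1 size_eq0.
have [m mK] := iter_rot1K n w.
by apply: (wprim (iter m (rot 1) P) k k2); rewrite -iter_rot1_pow -wP mK.
Qed.

Section ClosedWords.
Variable T : finType.

Fixpoint words k : seq (seq T) :=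
  if k is k'.+1 then [seq x :: w | x <- enum T, w <- words k'] else [:: [::]].

Lemma mem_words k w : (w \in words k) = (size w == k).
Proof.
elim: k w => [|k IHk] [|x w] //=.
  by apply/allpairsP => -[[y v] []].
apply/allpairsP/eqP => [[[y v] /= [_ + [_ ->]]]|[szw]].
  by rewrite IHk => /eqP ->.
by exists (x, w); rewrite mem_enum IHk szw eqxx.
Qed.

Lemma words_uniq k : uniq (words k).
Proof.
elim: k => //= k IHk; apply: allpairs_uniq => //; first exact: enum_uniq.
by move=> [x v] [y w] _ _ [-> ->].
Qed.

Lemma size_words k : size (words k) = (#|T| ^ k)%N.
Proof. by elim: k => //= k IHk; rewrite size_allpairs IHk expnS -cardE. Qed.

(* s represents, once each, the cyclic classes of the primitive e-cycles of
   length at most k, and possibly longer ones. *)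
Definition cycle_reps (e : rel T) k (s : seq (seq T)) : Prop :=
  [/\ uniq s,
      forall Q, Q \in s -> primitive_word Q /\ path.cycle e Q,
      forall P Q n, P \in s -> Q \in s -> Q = iter n (rot 1) P -> P = Q
    & forall P, primitive_word P -> path.cycle e P -> (size P <= k)%N ->
        exists n, iter n (rot 1) P \in s].

(** A closed word of length [k] is, in exactly one way, a power of one of the [size Q] shifts of a
    representative [Q], and [chi] is the same for all these shifts. The bound [k <= m] ensures that
    its root is represented. *)
Lemma sum_closed_words (V : nmodType) (chi : seq T -> V) (e : rel T) m k s :
  (forall w, chi (rot 1 w) = chi w) -> cycle_reps e m s ->
  (0 < k <= m)%N ->
  \sum_(w <- words k | path.cycle e w) chi w =
  \sum_(Q <- s | (size Q %| k)%N)
     chi (word_pow (k %/ size Q) Q) *+ size Q.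
Proof.
move=> chi_rot [s_uniq s_prim s_inj s_all] /andP[k_gt0 lekm].
have chi_iter n w : chi (iter n (rot 1) w) = chi w.
  by elim: n => //= n <-.
have sz_gt0 Q : Q \in s -> (0 < size Q)%N.
  by move=> /s_prim[[Q0 _] _]; rewrite lt0n size_eq0.
pose s' := [seq Q <- s | (size Q %| k)%N].
pose L := [seq word_pow (k %/ size Q) (iter i (rot 1) Q)
             | Q <- s', i <- iota 0 (size Q)].
have -> : \sum_(Q <- s | (size Q %| k)%N)
     chi (word_pow (k %/ size Q) Q) *+ size Q = \sum_(w <- L) chi w.
  rewrite big_allpairs_dep big_filter; apply: eq_bigr => Q _.
  rewrite (eq_bigr (fun=> chi (word_pow (k %/ size Q) Q))).
    by rewrite big_const_seq count_predT size_iota iter_addr_0.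
  by move=> i _; rewrite -iter_rot1_pow chi_iter.
(* It remains to see that [L] lists the closed words of length [k], each once. *)
rewrite -big_filter; apply: perm_big; apply: uniq_perm.
- by rewrite filter_uniq // words_uniq.
- apply: allpairs_uniq_dep => [|Q _|]; [by rewrite filter_uniq|exact: iota_uniq|].
  move=> _ _ /allpairsPdep[P [i [sP + ->]]] /allpairsPdep[Q [j [sQ + ->]]] /=.
  rewrite !mem_iota /= !add0n => ltiP ltjQ PQ.
  move: sP sQ; rewrite !mem_filter => /andP[Pk sP] /andP[Qk sQ].
  have E : iter i (rot 1) P = iter j (rot 1) Q.
    apply: primitive_root_unique PQ; try apply: primitive_iter_rot1.
    - by have [] := s_prim _ sP.
    - by have [] := s_prim _ sQ.
    - by rewrite divn_gt0 ?sz_gt0 // dvdn_leq.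
    - by rewrite divn_gt0 ?sz_gt0 // dvdn_leq.
  have [n nK] := iter_rot1K i P.
  have PQ' : Q = P.
    by apply: (s_inj _ _ (n + j)%N) => //; rewrite iterD -E nK.
  move: E ltjQ; rewrite {}PQ' => E ltjP.
  wlog leij : i j ltiP ltjP E {PQ nK} / (i <= j)%N.
    by move=> W; case/orP: (leq_total i j) => ?; [exact: W|apply/esym; exact: W].
  suff -> : i = j by [].
  (* The difference [j - i] is a period of a primitive word, yet smaller than its length, so it
     vanishes. *)
  have /primitive_word_period : iter (j - i) (rot 1) (iter i (rot 1) P) =
      iter i (rot 1) P by rewrite -iterD subnK // E.
  move=> /(_ (primitive_iter_rot1 _ (s_prim _ sP).1)).
  rewrite size_iter_rot1; case: (posnP (j - i)) => [/eqP|gt0 /(dvdn_leq gt0)].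
    by rewrite subn_eq0 => leji _; apply/eqP; rewrite eqn_leq leij.
  by rewrite leqNgt (leq_ltn_trans (leq_subr i j) ltjP).
move=> w; rewrite mem_filter mem_words; apply/andP/allpairsPdep.
  move=> [wcyc /eqP szw].
  have w0 : w != [::] by rewrite -size_eq0 szw -lt0n.
  have [P [j [Pprim j_gt0 wP]]] := primitive_root_exists w0.
  have szP : k = (j * size P)%N by rewrite -szw wP size_word_pow.
  have sP0 : (0 < size P)%N by case: Pprim => P0 _; rewrite lt0n size_eq0.
  have [||n sQ] := s_all P Pprim.
  - by rewrite wP cycle_word_pow in wcyc.
  - by apply: leq_trans lekm; rewrite szP leq_pmull.
  have [i iK] := iter_rot1K n P.
  (* The number of shifts leading from the representative back to [P] only matters modulo
     [size P]. *)
  exists (iter n (rot 1) P), (i %% size P)%N.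
  rewrite mem_filter size_iter_rot1 sQ mem_iota ltn_mod sP0 szP dvdn_mull //.
  split=> //; rewrite mulnK // wP -{1}iK; congr word_pow.
  rewrite {1}(divn_eq i (size P)) addnC iterD.
  by rewrite iter_rot1_period // -(size_iter_rot1 n P) iter_rot1_size.
move=> [Q [i [+ _ ->]]]; rewrite mem_filter => /andP[Qk sQ].
rewrite size_word_pow size_iter_rot1 divnK //; split=> //.
rewrite cycle_word_pow ?cycle_iter_rot1; first by have [] := s_prim _ sQ.
by rewrite divn_gt0 ?sz_gt0 // dvdn_leq.
Qed.

End ClosedWords.

(** * Traces of walk matrices and logarithmic derivatives *)

Section FinBlocks.
Variables (K : comPzRingType) (d : nat).

(** Rectangular variant of [vblock_mx] over arbitrary finite types, so that letters, half-edges and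
    vertices can all index blocks; on vertices the two agree by conversion. *)
Definition fin_block_mx (I J : finType) (B : I -> J -> 'M[K]_d) :
    'M[K]_(\sum_(i < #|I|) d, \sum_(j < #|J|) d) :=
  \mxblock_(i < #|I|, j < #|J|) B (enum_val i) (enum_val j).

Lemma eq_fin_block_mx (I J : finType) (A B : I -> J -> 'M[K]_d) :
  A =2 B -> fin_block_mx A = fin_block_mx B.
Proof. by move=> AB; apply/eq_mxblock => i j; rewrite AB. Qed.

Lemma fin_block_mxM (I J L : finType) (A : I -> J -> 'M[K]_d)
    (B : J -> L -> 'M[K]_d) :
  fin_block_mx A *m fin_block_mx B =
  fin_block_mx (fun i l => \sum_j A i j *m B j l).
Proof.
rewrite mul_mxblock; apply/eq_mxblock => i l.
by rewrite [RHS](reindex _ (onW_bij _ (@enum_val_bij _))).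
Qed.

Lemma fin_block_mxB (I J : finType) (A B : I -> J -> 'M[K]_d) :
  fin_block_mx A - fin_block_mx B = fin_block_mx (fun i j => A i j - B i j).
Proof. by rewrite -mxblockB. Qed.

Lemma fin_block_mx1 (I : finType) :
  fin_block_mx (fun i j : I => if i == j then 1%:M else 0) = 1%:M.
Proof.
rewrite -mxdiagZ; apply/eq_mxblock => i j; rewrite (inj_eq enum_val_inj).
by case: (i == j) => //; rewrite conform_mx_id.
Qed.

Lemma mxtrace_fin_block_mx (I : finType) (B : I -> I -> 'M[K]_d) :
  \tr (fin_block_mx B) = \sum_i \tr (B i i).
Proof.
rewrite mxtrace_mxblock.
by rewrite [RHS](reindex _ (onW_bij _ (@enum_val_bij _))).
Qed.

Section Walks.
Variables (T : finType) (e : rel T) (f : T -> 'M[K]_d).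

(** The weight sits on the source of each step, so a closed walk collects each of its letters
    exactly once. *)
Definition walk_mx : 'M[K]_(\sum_(i < #|T|) d) :=
  fin_block_mx (fun x y => if e x y then f x else 0).

Definition word_mx (w : seq T) : 'M[K]_d := \big[mulmx/1%:M]_(x <- w) f x.

Lemma walk_mx_exp k :
  walk_mx ^+ k.+1 =
  fin_block_mx (fun x y =>
    \sum_(w <- words T k | path e x (rcons w y)) word_mx (x :: w)).
Proof.
elim: k => [|k IHk].
  rewrite expr1; apply: eq_fin_block_mx => x y.
  by rewrite /= big_mkcond big_seq1 /= andbT /word_mx big_cons big_nil mulmx1.
rewrite exprS IHk -mulmxE fin_block_mxM; apply: eq_fin_block_mx => x y.
rewrite [RHS]big_mkcond big_allpairs_dep big_enum /=; apply: eq_bigr => z _.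
case: (e x z) => /=; last by rewrite mul0mx big1.
rewrite mulmx_sumr big_mkcond /=; apply: eq_bigr => w _.
by case: ifP => _; rewrite ?mulmx0 // [in RHS]/word_mx big_cons.
Qed.

Lemma mxtrace_walk_mx k :
  \tr (walk_mx ^+ k.+1) =
  \sum_(w <- words T k.+1 | path.cycle e w) \tr (word_mx w).
Proof.
rewrite walk_mx_exp mxtrace_fin_block_mx [RHS]big_mkcond big_allpairs_dep /=.
rewrite big_enum /=; apply: eq_bigr => x _.
by rewrite raddf_sum /= big_mkcond.
Qed.

End Walks.
End FinBlocks.

Section LogDerivative.
Variable C : numFieldType.
Implicit Types (p q : {poly C}) (a b : nat -> C).

(* X p'/p = - sum_k a_k X^k modulo X^(n+1) *)
Definition log_deriv n p a : Prop :=
  forall k, (k <= n)%N -> ('X * p^`() + p * \poly_(i < n.+1) a i)`_k = 0.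

Lemma coefM_eq0 n p q : (forall k, (k <= n)%N -> p`_k = 0) ->
  forall k, (k <= n)%N -> (q * p)`_k = 0.
Proof.
move=> p0 k lekn; rewrite coefM big1 // => i _.
by rewrite p0 ?mulr0 // (leq_trans (leq_subr _ _)).
Qed.

Lemma log_derivM n p q a b : log_deriv n p a -> log_deriv n q b ->
  log_deriv n (p * q) (fun k => a k + b k).
Proof.
move=> pa qb k lekn.
have -> : \poly_(i < n.+1) (a i + b i) =
    \poly_(i < n.+1) a i + \poly_(i < n.+1) b i.
  by apply/polyP => i; rewrite coefD !coef_poly; case: ifP; rewrite ?addr0.
set A := \poly_(i < n.+1) a i; set B := \poly_(i < n.+1) b i.
have -> : 'X * (p * q)^`() + p * q * (A + B) =
    q * ('X * p^`() + p * A) + p * ('X * q^`() + q * B).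
  by rewrite derivM; ring.
by rewrite coefD (coefM_eq0 q pa) // (coefM_eq0 p qb) // addr0.
Qed.

Lemma eq_log_deriv n p a b : (forall k, (k <= n)%N -> a k = b k) ->
  log_deriv n p a -> log_deriv n p b.
Proof.
move=> ab pa k lekn; rewrite (_ : \poly_(i < n.+1) b i = \poly_(i < n.+1) a i).
  exact: pa.
by apply: eq_poly => i lein; rewrite ab.
Qed.

Lemma log_deriv_prod n (I : eqType) (r : seq I) (p : I -> {poly C})
    (a : I -> nat -> C) :
  (forall i, i \in r -> log_deriv n (p i) (a i)) ->
  log_deriv n (\prod_(i <- r) p i) (fun k => \sum_(i <- r) a i k).
Proof.
elim: r => [|i r IHr] pa.
  move=> k lekn; rewrite big_nil derivC mulr0 add0r mul1r coef_poly ltnS lekn.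
  by rewrite big_nil.
have {}IHr := IHr (fun j rj => pa j (@mem_behead _ (i :: r) j rj)).
rewrite big_cons; apply: (eq_log_deriv _ (log_derivM (pa i (mem_head _ _)) IHr)).
by move=> k _; rewrite big_cons.
Qed.

(** In degree [k + 1] the relation expresses [(k + 1) p_(k+1)] through lower coefficients, because
    [a 0 = 0]; in characteristic 0 this is a recursion determining [p]. *)
Lemma log_deriv_inj n p q a : a 0%N = 0 -> p`_0 = 1 -> q`_0 = 1 ->
  log_deriv n p a -> log_deriv n q a -> forall k, (k <= n)%N -> p`_k = q`_k.
Proof.
move=> a0 p0 q0 pa qa; elim/ltn_ind => -[|k] IHk lekn; first by rewrite p0.
have expand (r : {poly C}) : ('X * r^`() + r * \poly_(i < n.+1) a i)`_k.+1 =
    r`_k.+1 *+ k.+1 + \sum_(i < k.+1) r`_i * (\poly_(i < n.+1) a i)`_(k.+1 - i).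
  rewrite coefD coefXM /= coef_deriv coefM big_ord_recr /= subnn.
  by rewrite coef_poly a0 mulr0 addr0.
have := etrans (pa _ lekn) (esym (qa _ lekn)); rewrite !expand.
rewrite [X in _ + X = _](_ : _ = \sum_(i < k.+1)
    q`_i * (\poly_(i < n.+1) a i)`_(k.+1 - i)); last first.
  apply: eq_bigr => i _; rewrite IHk // ltnW //.
  exact: leq_trans (ltn_ord i) lekn.
by move/addIr/eqP; rewrite -subr_eq0 -mulrnBl mulrn_eq0 subr_eq0 => /eqP.
Qed.

(** This is the geometric series of [l z X^l / (1 - z X^l)], which has no constant term; hence the
    condition [0 < k]. *)
Lemma log_deriv_1BX n z l : (0 < l)%N ->
  log_deriv n (1 - z *: 'X^l)
    (fun k => if (0 < k)%N && (l %| k)%N then z ^+ (k %/ l) *+ l else 0).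
Proof.
move=> l_gt0 k lekn.
have -> : 'X * (1 - z *: 'X^l)^`() = - ((z *+ l) *: 'X^l).
  rewrite derivB derivC sub0r derivZ derivXn mulrN -scalerAr mulrnAr -exprS.
  by rewrite prednK // -scalerMnr scalerMnl.
rewrite mulrBl mul1r -scalerAl coefD coefN coefB !coefZ coefXn coefXnM.
rewrite !coef_poly ltnS lekn.
have [->|k_gt0] := posnP k.
  by rewrite /= l_gt0 eq_sym (gtn_eqF l_gt0) !mulr0 subr0 oppr0 addr0.
have [ltkl|lelk] := ltnP k l.
  by rewrite ltn_eqF // gtnNdvd // andbF /= !mulr0 subr0 oppr0 addr0.
rewrite ltnS (leq_trans (leq_subr _ _) lekn) dvdn_subl // subn_gt0.
have [ltlk|gelk|->] := ltngtP l k; rewrite ?dvdnn /=.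
- case: ifP => [lk|_]; last by rewrite !mulr0 oppr0 !addr0.
  rewrite mulr0 oppr0 add0r mulrnAr -exprS divnBr // divnn l_gt0.
  by rewrite subn1 prednK ?divn_gt0 // subrr.
- by rewrite ltnNge lelk in gelk.
by rewrite divnn k_gt0 mulr1 mulr0 subr0 expr1 addNr.
Qed.

End LogDerivative.

(** * The Euler product of primitive closed walks *)

Section Majorant.
Variable C : numFieldType.
Implicit Types (p q : {poly C}) (r u z : C).

(** A weighted sum norm on coefficients. The explicit cutoff [N] lets polynomials of different
    degrees be compared over one range. *)
Definition abs_horner N p r : C := \sum_(i < N) `|p`_i| * r ^+ i.

Lemma abs_horner_wide N p r :
  (size p <= N)%N -> abs_horner N p r = abs_horner (size p) p r.
Proof.
move=> szp; rewrite /abs_horner.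
rewrite -!(big_mkord xpredT (fun i => `|p`_i| * r ^+ i)).
rewrite (big_cat_nat (n := size p)) //= [X in _ + X]big_nat.
rewrite [X in _ + X]big1 ?addr0 // => i /andP[szi _].
by rewrite nth_default // normr0 mul0r.
Qed.

Lemma abs_horner_1BX N z l p r : 0 <= r -> `|z| <= 1 ->
  abs_horner N ((1 - z *: 'X^l) * p) r <= (1 + r ^+ l) * abs_horner N p r.
Proof.
move=> r0 z1; rewrite [leRHS]mulrDl [in leRHS]mul1r.
apply: (@le_trans _ _ (\sum_(i < N) (`|p`_i| * r ^+ i +
    (if (l <= i)%N then r ^+ l * (`|p`_(i - l)| * r ^+ (i - l)) else 0)))).
  apply: ler_sum => i _; rewrite mulrBl mul1r -scalerAl coefB coefZ coefXnM.
  apply: (@le_trans _ _ ((`|p`_i| + `|if (i < l)%N then 0 else p`_(i - l)|)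
     * r ^+ i)).
    rewrite ler_wpM2r ?exprn_ge0 //; apply: le_trans (ler_normB _ _) _.
    by rewrite lerD2l normrM ler_piMl.
  rewrite mulrDl lerD2l; case: ltnP => [_|leli]; first by rewrite normr0 mul0r.
  by rewrite mulrCA -exprD subnKC.
(* After reindexing, the second sum is an initial segment of [r ^+ l] times the norm of [p]. *)
rewrite big_split /= lerD2l /abs_horner mulr_sumr -big_mkcond /=.
set F := fun i => r ^+ l * (`|p`_i| * r ^+ i).
have F0 i : 0 <= F i by rewrite !mulr_ge0 ?exprn_ge0.
rewrite -(big_mkord (fun i => l <= i)%N (fun i => F (i - l)%N)).
rewrite -(big_mkord xpredT F).
have [leNl|/ltnW leNl] := leqP N l.
  rewrite big_nat_cond big_pred0 ?sumr_ge0 // => i.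
  by apply/negP => /andP[/andP[_ ltiN]]; rewrite leqNgt (leq_trans ltiN leNl).
rewrite (big_cat_nat (n := l)) //= big_nat_cond big_pred0; last first.
  by move=> i; case: leqP => //; rewrite andbF.
rewrite add0r big_mkcond -{1}[l]add0n big_addn /=.
rewrite [leRHS](big_cat_nat (n := (N - l)%N)) ?leq_subr //=.
apply: ler_wpDr; first by rewrite sumr_ge0.
by apply: ler_sum => i _; rewrite addnK leq_addl.
Qed.

Lemma abs_horner_prod N (s : seq (C * nat)) r : 0 <= r ->
  (forall t, t \in s -> `|t.1| <= 1) ->
  abs_horner N (\prod_(t <- s) (1 - t.1 *: 'X^(t.2))) r <=
  \prod_(t <- s) (1 + r ^+ t.2).
Proof.
move=> r0; elim: s => [|t s IHs] s1.
  rewrite !big_nil /abs_horner; case: N => [|N]; first by rewrite big_ord0.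
  rewrite big_ord_recl /= coef1 normr1 expr0 mulr1 big1 ?addr0 // => i _.
  by rewrite coef1 normr0 mul0r.
rewrite !big_cons; apply: le_trans (abs_horner_1BX _ _ _ r0 _) _.
  by rewrite s1 ?mem_head.
rewrite ler_wpM2l ?addr_ge0 ?exprn_ge0 // IHs // => t' st'.
by rewrite s1 // inE st' orbT.
Qed.

(** By induction the product times [1 - \sum a i] is at most 1, and this second factor is at least
    one half. *)
Lemma prod_1D_le2 (I : Type) (s : seq I) (a : I -> C) : (forall i, 0 <= a i) ->
  \sum_(i <- s) a i <= 2^-1 -> \prod_(i <- s) (1 + a i) <= 2.
Proof.
move=> a0 sum_le.
suff : (\prod_(i <- s) (1 + a i)) * (1 - \sum_(i <- s) a i) <= 1.
  move=> le1; have P0 : 0 <= \prod_(i <- s) (1 + a i).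
    by apply: prodr_ge0 => i _; rewrite addr_ge0.
  have : \prod_(i <- s) (1 + a i) * 2^-1 <= 1.
    apply: le_trans le1; rewrite ler_wpM2l // lerBrDr -lerBrDl.
    by apply: le_trans sum_le _; rewrite {2}(splitr 1) mul1r addrK.
  by rewrite ler_pdivrMr ?mul1r.
elim: s {sum_le} => [|i s IHs]; first by rewrite !big_nil subr0 mulr1.
rewrite !big_cons; apply: le_trans IHs.
have S0 : 0 <= \sum_(i <- s) a i by apply: sumr_ge0.
have P0 : 0 <= \prod_(i <- s) (1 + a i).
  by apply: prodr_ge0 => j _; rewrite addr_ge0.
set S := \sum_(i <- s) a i in S0 *; set P := \prod_(i <- s) _ in P0 *.
rewrite -subr_ge0.
have -> : P * (1 - S) - (1 + a i) * P * (1 - (a i + S)) =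
  P * (a i * (a i + S)) by ring.
by rewrite !mulr_ge0 ?addr_ge0.
Qed.

(** Coefficients up to degree [n] cancel; beyond it, [(r / 2) ^ i <= 2^-n * r ^ i]. Halving the
    radius buys the geometric factor. *)
Lemma horner_close n N p q r u : 0 < r -> `|u| <= r / 2 ->
  (size p <= N)%N -> (size q <= N)%N ->
  (forall k, (k <= n)%N -> p`_k = q`_k) ->
  `|p.[u] - q.[u]| <= 2^-1 ^+ n * (abs_horner N p r + abs_horner N q r).
Proof.
move=> r0 ur szp szq pq; rewrite !(horner_coef_wide _ szp, horner_coef_wide _ szq).
rewrite -sumrB -big_split /= mulr_sumr; apply: le_trans (ler_norm_sum _ _ _) _.
apply: ler_sum => i _; have [lein|ltni] := leqP i n.
  have A0 k : 0 <= `|q`_k| * r ^+ k by rewrite mulr_ge0 // exprn_ge0 // ltW.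
  by rewrite pq // subrr normr0 mulr_ge0 ?addr_ge0 // exprn_ge0 // invr_ge0.
rewrite -mulrBl -mulrDl normrM normrX.
apply: (@le_trans _ _ ((`|p`_i| + `|q`_i|) * (r / 2) ^+ i)).
  by rewrite ler_pM ?exprn_ge0 ?normr_ge0 ?ler_normB // lerXn2r ?nnegrE //
    ?divr_ge0 ?ltW.
rewrite mulrCA ler_wpM2l ?addr_ge0 // exprMn mulrC.
apply: ler_wpM2r; first by rewrite exprn_ge0 // ltW.
by apply: ler_wiXn2l; rewrite ?(ltnW ltni) ?invr_ge0 // invf_le1 ?ltr0n ?ler1n.
Qed.

End Majorant.

Section EulerEstimate.
Variables (C : numClosedFieldType) (gT : finGroupType) (d : nat).
Variable rho : mx_representation C [set: gT]%SET d.
Variables (T : finType) (e : rel T) (phi : T -> gT).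

Definition word_weight (w : seq T) : gT := (\prod_(x <- w) phi x)%g.

Definition walk_det u : C :=
  \det (1%:M - u *: walk_mx e (fun x => rho (phi x))).

Definition word_factor u (Q : seq T) : C :=
  \det (1%:M - u ^+ size Q *: rho (word_weight Q)).

Lemma word_mx_repr w : word_mx (fun x => rho (phi x)) w = rho (word_weight w).
Proof.
rewrite /word_mx /word_weight; elim: w => [|x w IHw].
  by rewrite !big_nil repr_mx1.
by rewrite !big_cons IHw repr_mxM ?inE.
Qed.

Lemma repr_mx_exp g k : rho (g ^+ k)%g = rho g ^+ k.
Proof.
elim: k => [|k IHk]; first by rewrite expr0 expg0 repr_mx1.
by rewrite expgS exprS repr_mxM ?inE // IHk.
Qed.

Lemma word_weight_pow k w :
  word_weight (word_pow k w) = (word_weight w ^+ k)%g.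
Proof.
elim: k => [|k IHk]; first by rewrite /word_weight big_nil.
by rewrite word_powS expgS -IHk /word_weight big_cat.
Qed.

Lemma word_char_rot1 w :
  \tr (rho (word_weight (rot 1 w))) = \tr (rho (word_weight w)).
Proof.
case: w => // x w; rewrite rot1_cons -cats1 /word_weight big_cat big_cons.
by rewrite big_cons big_nil /= mulg1 !repr_mxM ?inE // mxtrace_mulC.
Qed.

Lemma mxtrace_walk_mx_reps m k s : cycle_reps e m s -> (0 < k <= m)%N ->
  \tr (walk_mx e (fun x => rho (phi x)) ^+ k) =
  \sum_(Q <- s | (size Q %| k)%N)
     \tr (rho (word_weight Q) ^+ (k %/ size Q)) *+ size Q.
Proof.
case: k => // k reps lek; rewrite mxtrace_walk_mx.
rewrite (eq_bigr (fun w => \tr (rho (word_weight w)))); last first.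
  by move=> w _; rewrite word_mx_repr.
rewrite (sum_closed_words word_char_rot1 reps lek).
by apply: eq_bigr => Q _; rewrite word_weight_pow repr_mx_exp.
Qed.

(** There are [#|T| ^ k] words of length [k], so the sum is dominated by a geometric series of ratio
    at most one half, which starts in degree 1 as the empty word is excluded. *)
Lemma sum_words_le (s : seq (seq T)) (r : C) :
  0 <= r -> (forall Q, Q \in s -> Q != [::]) ->
  uniq s -> #|T|%:R * r <= 2^-1 ->
  \sum_(Q <- s) r ^+ size Q <= 2 * (#|T|%:R * r).
Proof.
move=> r0 s0 s_uniq; set y := #|T|%:R * r => ley.
have y0 : 0 <= y by rewrite mulr_ge0.
pose K := \max_(Q <- s) size Q.
have ltK (Q : seq T) : Q \in s -> (size Q < K.+1)%N.
  by move=> sQ; rewrite ltnS (leq_bigmax_seq _ sQ).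
have -> : \sum_(Q <- s) r ^+ size Q =
    \sum_(k < K.+1) \sum_(Q <- s | size Q == k) r ^+ size Q.
  rewrite (exchange_big_dep xpredT) //= big_seq [RHS]big_seq.
  by apply: eq_bigr => Q /ltK ltQ; rewrite (big_pred1 (Ordinal ltQ)).
(* Each partial sum is [y] times 1 plus the previous one, and the previous one is at most
   [2 y <= 1]. *)
have geo k : \sum_(i < k) y ^+ i.+1 <= 2 * y.
  elim: k => [|k IHk]; first by rewrite big_ord0 mulr_ge0.
  rewrite big_ord_recl expr1 mulr_natl mulr2n lerD2l.
  under eq_bigr do rewrite exprS; rewrite -mulr_sumr -[leRHS]mulr1 ler_wpM2l //.
  apply: le_trans IHk _; rewrite -(@ler_pM2l _ 2^-1) ?invr_gt0 // mulr1 mulKf //.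
  by rewrite pnatr_eq0.
apply: le_trans (geo K); rewrite big_ord_recl /= big1_seq ?add0r; last first.
  by move=> Q /andP[/eqP/size0nil -> /s0].
apply: ler_sum => i _; rewrite /bump /= add1n.
rewrite (eq_bigr (fun=> r ^+ i.+1)); last by move=> Q /eqP ->.
rewrite big_const_seq iter_addr_0 -mulr_natl exprMn ler_wpM2r ?exprn_ge0 //.
rewrite -natrX ler_nat -size_words -size_filter.
apply: uniq_leq_size; first by rewrite filter_uniq.
by move=> Q; rewrite mem_filter mem_words => /andP[].
Qed.

(** The point is uniformity: [r] and [K] depend on neither [n] nor [s], so agreement of the
    coefficients up to degree [n] becomes convergence. *)
Theorem euler_estimate : exists r K : C, 0 < r /\
  forall n s u, cycle_reps e n s -> `|u| <= r / 2 ->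
    `|\prod_(Q <- s) word_factor u Q - walk_det u| <= 2^-1 ^+ n * K.
Proof.
have [E EP] := choice (fun Q => eigen_seq_exists (rho (word_weight Q))).
set N := walk_mx e (fun x => rho (phi x)).
have [t [_ _ trt dett _]] := eigen_seq_exists N.
pose q : {poly C} := \prod_(z <- t) (1 - z *: 'X^1).
(* Chosen so that [#|T| r <= 1 / (4 (d + 1))], whence [d] times the sum of [r ^+ size Q] is at most
   one half. The successors keep [r] defined when [d] or [#|T|] is 0. *)
pose r : C := (4 * d.+1%:R * #|T|.+1%:R)^-1.
have r_gt0 : 0 < r by rewrite invr_gt0 !mulr_gt0.
(* The 2 bounds the norm of the finite Euler product, by [prod_1D_le2]; the other term is the norm
   of the determinant. *)
exists r, (2 + abs_horner (size q) q r); split=> // n s u reps ler.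
have [s_uniq s_prim _ _] := reps.
have s_gt0 Q : Q \in s -> (0 < size Q)%N.
  by move=> /s_prim[[Q0 _] _]; rewrite lt0n size_eq0.
pose s2 := [seq (z, size Q) | Q <- s, z <- E Q].
pose p : {poly C} := \prod_(x <- s2) (1 - x.1 *: 'X^(x.2)).
have pE : p = \prod_(Q <- s) \prod_(z <- E Q) (1 - z *: 'X^(size Q)).
  by rewrite /p big_allpairs_dep.
have pu : \prod_(Q <- s) word_factor u Q = p.[u].
  rewrite pE horner_prod; apply: eq_bigr => Q _; rewrite horner_prod /word_factor.
  have [_ _ _ -> _] := EP Q; apply: eq_bigr => z _.
  by rewrite !hornerE.
have qu : walk_det u = q.[u].
  rewrite /walk_det dett horner_prod; apply: eq_bigr => z _.
  by rewrite !hornerE.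
(* The value at 0 is set to 0, not to the trace of the identity, as logarithmic derivatives have no
   constant term. *)
pose a k := if (0 < k)%N then \tr (N ^+ k) else 0.
have qa : log_deriv n q a.
  have qa' : forall z, z \in t -> log_deriv n (1 - z *: 'X^1) _ :=
    fun z _ => @log_deriv_1BX _ n z _ (ltn0Sn 0).
  apply: (eq_log_deriv _ (log_deriv_prod qa')) => k _.
  rewrite /a; case: ifP => [k_gt0|_]; last by rewrite big1.
  by rewrite trt; apply: eq_bigr => z _; rewrite dvd1n divn1 mulr1n.
have pa : log_deriv n p a.
  rewrite pE.
  have pa' : forall Q, Q \in s ->
      log_deriv n (\prod_(z <- E Q) (1 - z *: 'X^(size Q))) _ :=
    fun Q sQ => log_deriv_prod (fun z _ => @log_deriv_1BX _ n z _ (s_gt0 Q sQ)).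
  apply: (eq_log_deriv _ (log_deriv_prod pa')) => k lekn.
  rewrite /a; case: ifP => [k_gt0|_]; last by rewrite big1 // => *; rewrite big1.
  rewrite (mxtrace_walk_mx_reps reps) ?k_gt0 // [RHS]big_mkcond.
  apply: eq_bigr => Q _ /=; case: ifP => _; last by rewrite big1.
  by have [_ _ -> _ _] := EP Q; rewrite -sumrMnl.
have p0 : p`_0 = 1.
  rewrite -horner_coef0 pE horner_prod big_seq big1 // => Q sQ.
  rewrite horner_prod big1 // => z _.
  by rewrite !hornerE expr0n gtn_eqF ?s_gt0 // mulr0 subr0.
have q0 : q`_0 = 1.
  by rewrite -horner_coef0 horner_prod big1 // => z _; rewrite !hornerE ?mulr0 ?subr0.
have pq := log_deriv_inj (erefl : a 0%N = 0) p0 q0 pa qa.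
rewrite pu qu; apply: le_trans.
  exact: (horner_close (N := maxn (size p) (size q)) r_gt0 ler (leq_maxl _ _)
    (leq_maxr _ _) pq).
rewrite (abs_horner_wide _ (leq_maxr _ _)).
rewrite ler_wpM2l ?exprn_ge0 ?invr_ge0 // lerD2r.
apply: le_trans (abs_horner_prod _ (ltW r_gt0) _) _.
  move=> _ /allpairsPdep[Q [z [_ Ez ->]]] /=.
  have [_ _ _ _ idem] := EP Q.
  (* By Lagrange [rho] of any element has order dividing [#|gT|], so its eigenvalues have modulus
     1. *)
  have /idem/(_ z Ez)/(congr1 Num.norm) : rho (word_weight Q) ^+ #|gT| = 1.
    rewrite -repr_mx_exp -cardsT (_ : (_ ^+ _)%g = 1%g) ?repr_mx1 //.
    by apply/eqP; rewrite -order_dvdn order_dvdG ?inE.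
  rewrite normr1 normrX => /eqP.
  rewrite pexpr_eq1 // => [/eqP -> //|].
  by rewrite -cardsT cardG_gt0.
apply: prod_1D_le2 => [i|]; first by rewrite exprn_ge0 // ltW.
rewrite big_allpairs_dep.
have -> : \sum_(Q <- s) \sum_(z <- E Q) r ^+ (z, size Q).2 =
    d%:R * \sum_(Q <- s) r ^+ size Q.
  rewrite mulr_sumr; apply: eq_bigr => Q _ /=.
  have [sz _ _ _ _] := EP Q.
  by rewrite big_const_seq count_predT sz iter_addr_0 mulr_natl.
have ley : #|T|%:R * r <= (4 * d.+1%:R)^-1.
  rewrite /r invfM mulrCA -[leRHS]mulr1 ler_wpM2l ?invr_ge0 ?mulr_ge0 //.
  by rewrite ler_pdivrMr ?ltr0n // mul1r ler_nat.
have lt2 : (4 * d.+1%:R)^-1 <= 2^-1 :> C.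
  by rewrite lef_pV2 ?posrE ?mulr_gt0 ?ltr0n // -natrM ler_nat; lia.
apply: (@le_trans _ _ (d%:R * (2 * (4 * d.+1%:R)^-1))).
  rewrite ler_wpM2l //; apply: (le_trans (sum_words_le (ltW r_gt0) _ s_uniq _)).
  - by move=> Q /s_prim[[]].
  - exact: le_trans ley lt2.
  by rewrite ler_wpM2l.
rewrite mulrA ler_pdivrMr ?mulr_gt0 ?ltr0n //.
have -> : 2^-1 * (4 * d.+1%:R) = d.+1%:R * 2 :> C.
  by rewrite (natrM _ 2 2) -!mulrA mulKf ?pnatr_eq0 // mulrC.
by rewrite ler_wpM2r // ler_nat.
Qed.

End EulerEstimate.

(** * Bass's determinant formula *)

Lemma card_half_edge (X : graph) :
  #|half_edge X| = (#|edges X| * 2 + #|[pred h : half_edge X | is_leg h]|)%N.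
Proof.
rewrite -(cardC [pred h : half_edge X | is_leg h]) addnC; congr (_ + _)%N.
rewrite -[LHS]sum1_card.
rewrite (partition_big_imset (fun h : half_edge X => [set h; bar h]%SET)) /=.
have -> : [set [set h; bar h]%SET | h in [predC [pred h : half_edge X | is_leg h]]]%SET
    = edges X.
  by apply/setP => A; apply/imsetP/imsetP => -[h hP ->]; exists h; rewrite ?inE in hP *.
rewrite -sum_nat_const; apply: eq_bigr => _ /imsetP[h hleg ->].
rewrite inE in hleg; rewrite sum1_card.
have <- : #|[set h; bar h]%SET| = 2%N by rewrite cards2 eq_sym -/(is_leg h) hleg.
apply: eq_card => k; rewrite !inE; apply/andP/orP => [[_ /eqP hk]|].
  have : k \in [set k; bar k]%SET by rewrite !inE eqxx.
  by rewrite hk !inE => /orP.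
case=> /eqP ->; first by rewrite inE hleg eqxx.
rewrite inE barK finset.setUC eqxx; split=> //.
by apply: contra hleg => /eqP; rewrite barK => hE; rewrite /= /is_leg -hE.
Qed.

Section Bass.
Variables (C : numClosedFieldType) (gT : finGroupType) (d : nat).
Variable rho : mx_representation C [set: gT]%SET d.
Variables (X : graph_of_groups gT) (F : half_edge (underlying X) -> gT).
Hypothesis FK : forall h, (F h * F (bar h))%g = 1%g.

Let H := half_edge (underlying X).
Let V := vertex (underlying X).

(** What may follow a letter depends only on its half-edge; this is why the group elements can be
    eliminated. *)
Definition turn (h : H) (y : gT * H) : bool :=
  [&& Defs.root y.2 == Defs.root (bar h), y.1 \in vgroup (Defs.root (bar h))
    & (y.2 != bar h) || (y.1 != 1%g)].

Definition letter_rel : rel (gT * H) := fun x y => turn x.2 y.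

Definition letter_weight (x : gT * H) : gT := (x.1 * F x.2)%g.

Let Cv (v : V) : 'M[C]_d := \sum_(g in vgroup v) rho g.

(** [S] goes from a half-edge to its end, and [T] leaves a vertex with all group elements at once.
    So [S *m T] allows every continuation, and [J] is the forbidden one: back along the same edge
    with group element 1. *)
Let S := fin_block_mx (fun (h : H) (v : V) =>
  if Defs.root (bar h) == v then 1%:M else 0 : 'M[C]_d).
Let T := fin_block_mx (fun (v : V) (h : H) =>
  if Defs.root h == v then Cv v *m rho (F h) else 0 : 'M[C]_d).
Let J := fin_block_mx (fun h k : H =>
  if k == bar h then rho (F k) else 0 : 'M[C]_d).

(** The matrix on letters factors as [P *m K] through half-edges, and [det_1B_mulC] replaces it by
    [K *m P], which sums over the group elements. *)
Lemma walk_det_half_edge u :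
  walk_det rho letter_rel letter_weight u = \det (1%:M - u *: (S *m T - J)).
Proof.
pose P := fin_block_mx (fun (x : gT * H) (k : H) =>
  if x.2 == k then rho (letter_weight x) else 0 : 'M[C]_d).
pose K := fin_block_mx (fun (k : H) (y : gT * H) =>
  if turn k y then 1%:M else 0 : 'M[C]_d).
have -> : walk_det rho letter_rel letter_weight u =
    \det (1%:M - (u *: P) *m K).
  rewrite /walk_det -scalemxAl fin_block_mxM; congr (\det (_ - _ *: _)).
  apply: eq_fin_block_mx => x y; rewrite (bigD1 x.2) //= eqxx.
  rewrite big1 ?addr0 => [|k neqk]; last by rewrite eq_sym (negPf neqk) mul0mx.
  by rewrite /letter_rel; case: ifP; rewrite ?mulmx1 ?mulmx0.
rewrite det_1B_mulC -scalemxAr !fin_block_mxM fin_block_mxB.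
congr (\det (_ - _ *: _)); apply: eq_fin_block_mx => k k'.
rewrite [X in _ = X - _](bigD1 (Defs.root (bar k))) //= eqxx mul1mx.
rewrite [X in _ = _ + X - _]big1 ?addr0; last first.
  by move=> v neqv; rewrite eq_sym (negPf neqv) mul0mx.
rewrite -(pair_bigA _ (fun g h => (if turn k (g, h) then 1%:M else 0) *m
   (if h == k' then rho (letter_weight (g, h)) else 0))) /=.
transitivity (\sum_g if turn k (g, k') then rho (g * F k')%g else 0).
  apply: eq_bigr => g _; rewrite (bigD1 k') //= eqxx big1 ?addr0.
    by case: ifP => _; rewrite ?mul1mx ?mul0mx.
  by move=> h neqh; rewrite (negPf neqh) mulmx0.
rewrite /turn /=; case: eqVneq => [rk|rk] /=; last first.
  rewrite big1 // ifN ?subrr //.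
  by apply: contra rk => /eqP ->.
rewrite /Cv mulmx_suml -big_mkcond /=.
have rhoM g : rho g *m rho (F k') = rho (g * F k')%g by rewrite repr_mxM ?inE.
under [X in _ = X - _]eq_bigr do rewrite rhoM.
case: eqVneq => [_|_] /=; last by under eq_bigl do rewrite andbT; rewrite subr0.
(* For [k' = bar k] exactly the term of the identity is missing, and [J] accounts for it. *)
rewrite [in RHS](bigD1 1%g) ?group1 //= mul1g addrC addrK.
by [].
Qed.

Lemma J_involution : J *m J = 1%:M.
Proof.
rewrite fin_block_mxM -fin_block_mx1; apply: eq_fin_block_mx => h k.
rewrite (bigD1 (bar h)) //= eqxx barK big1 ?addr0 => [|k' /negPf ->]; last first.
  by rewrite mul0mx.
rewrite eq_sym; case: eqVneq => [->|_]; last by rewrite mulmx0.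
by rewrite -repr_mxM ?inE // -{2}[k]barK FK repr_mx1.
Qed.

Lemma fin_blocks_TS : T *m S =
  fin_block_mx (fun v w : V => Cv v *m
    \sum_(h : H | (Defs.root h == v) && (Defs.root (bar h) == w)) rho (F h)).
Proof.
rewrite fin_block_mxM; apply: eq_fin_block_mx => v w.
rewrite mulmx_sumr [RHS]big_mkcond; apply: eq_bigr => h _.
by case: eqP => _ /=; rewrite ?mul0mx //; case: eqP => _; rewrite ?mulmx1 ?mulmx0.
Qed.

(** Leaving along [h] and returning at once has weight [F h * F (bar h) = 1], so each half-edge at
    [v] contributes one copy of [Cv v]. *)
Lemma fin_blocks_TJS : T *m (J *m S) =
  fin_block_mx (fun v w : V => if v == w then Cv v *+ valency v else 0).
Proof.
rewrite !fin_block_mxM; apply: eq_fin_block_mx => v w.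
transitivity (\sum_(h : H | Defs.root h == v) if v == w then Cv v else 0).
  rewrite [RHS]big_mkcond; apply: eq_bigr => h _; case: eqP => [rh|_]; last first.
    by rewrite mul0mx.
  rewrite (bigD1 (bar h)) //= eqxx barK big1 ?addr0 => [|k /negPf ->]; last first.
    by rewrite mul0mx.
  rewrite rh; case: eqP => _; last by rewrite !mulmx0.
  by rewrite mulmx1 -mulmxA -repr_mxM ?inE // FK repr_mx1 mulmx1.
rewrite sumr_const /valency; case: eqP => _; last by rewrite mul0rn.
by [].
Qed.

Definition frob_mult z : nat :=
  \sum_(l : H | is_leg l) mup z (char_poly (rho (F l))).

Lemma det_1DJ u : \det (1%:M + u *: J) =
  (1 - u ^+ 2) ^+ (#|edges (underlying X)| * d) *
  (1 + u) ^+ frob_mult 1 * (1 - u) ^+ frob_mult (- 1).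
Proof.
have leg2 l : is_leg l -> rho (F l) *m rho (F l) = 1%:M.
  by move=> /eqP ll; rewrite -repr_mxM ?inE // -{2}ll FK repr_mx1.
set m := #|edges _|.
(* Each edge exchanges two blocks and so gives [d] eigenvalues of each sign; each leg gives those of
   [rho (F l)]. *)
rewrite (@det_involution _ _ _ (m * d + frob_mult 1) (m * d + frob_mult (- 1))).
- have -> : 1 - u ^+ 2 = (1 + u) * (1 - u) by ring.
  by rewrite exprMn !exprD mulrACA mulrA.
- exact: J_involution.
- rewrite big_const_ord iter_addn_0 addnACA -mulnDl /frob_mult -big_split /=.
  under eq_bigr => l ll do have [-> _ _] := involution_eigenvalues (leg2 l ll).
  rewrite sum_nat_const card_half_edge -/m; set L := #|[pred h | _]|.
  by lia.
(* Stated for arbitrary counts, so that [1] and [- 1] are never compared by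
   conversion. *)
have sumB (k : nat) (p q : H -> nat) :
    (k + \sum_(l | is_leg l) p l)%:R - (k + \sum_(l | is_leg l) q l)%:R =
    \sum_(l | is_leg l) ((p l)%:R - (q l)%:R) :> C.
  by rewrite !natrD opprD addrACA subrr add0r !natr_sum sumrB.
rewrite mxtrace_fin_block_mx sumB [RHS]big_mkcond; apply: eq_bigr => l _.
rewrite -[l == bar l]eq_sym -/(is_leg l).
case: ifP => [ll|_]; last by rewrite mxtrace0.
by have [_ -> _] := involution_eigenvalues (leg2 l ll).
Qed.

Theorem bass_formula u : 1 - u ^+ 2 != 0 ->
  walk_det rho letter_rel letter_weight u =
  (1 - u ^+ 2) ^ ((betti1 (underlying X) - 1) * d%:Z) *
  (1 + u) ^+ frob_mult 1 * (1 - u) ^+ frob_mult (- 1) *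
  \det (1%:M - u *: (fin_block_mx (fun v w : V => if v == w then Cv w else 0) *m
     fin_block_mx (fun v w : V =>
       \sum_(h : H | (Defs.root h == v) && (Defs.root (bar h) == w)) rho (F h)))
    + u ^+ 2 *: (fin_block_mx (fun v w : V => if v == w then Cv w else 0) *m
       fin_block_mx (fun v w : V =>
         if v == w then ((valency w)%:R)%:M else 0 : 'M[C]_d) - 1%:M)).
Proof.
move=> c_neq0.
have diagM (B : V -> V -> 'M[C]_d) :
    fin_block_mx (fun v w : V => if v == w then Cv w else 0) *m fin_block_mx B =
    fin_block_mx (fun v w => Cv v *m B v w).
  rewrite fin_block_mxM; apply: eq_fin_block_mx => v w.
  rewrite (bigD1 v) //= eqxx big1 ?addr0 // => x neqx.
  by rewrite eq_sym (negPf neqx) mul0mx.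
rewrite !diagM -fin_blocks_TS.
have -> : fin_block_mx (fun v w : V => Cv v *m
    (if v == w then ((valency w)%:R)%:M else 0 : 'M[C]_d)) = T *m (J *m S).
  rewrite fin_blocks_TJS; apply: eq_fin_block_mx => v w.
  case: eqP => [->|_]; first by rewrite mul_mx_scalar scaler_nat.
  by rewrite mulmx0.
have := det_walk_vertex S T J_involution c_neq0.
rewrite -walk_det_half_edge det_1DJ; move: (\det (_ + _)) => D.
rewrite big_const_ord iter_addn_0 => E.
(* The power [n d] from the vertices is divided out of the power [m d] from the edges. The
   difference may be negative, hence integer exponents and a nonzero base. *)
have cn_neq0 : (1 - u ^+ 2) ^+ (d * #|V|) != 0 by rewrite expf_neq0.
apply: (mulfI cn_neq0); rewrite E !mulrA; congr (_ * _ * _ * _).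
rewrite !(exprnP (1 - u ^+ 2)) -expfzDr //; congr (_ ^ _).
by rewrite /betti1 addrK !PoszM mulrBl [X in X + _]mulrC addrC subrK.
Qed.

End Bass.

(** * Primes as cyclic classes of words *)

Section PrimeReps.
Variables (gT : finGroupType) (X : graph_of_groups gT).
Implicit Types P Q : word X.

(** The first group element is tested at the root of the first half-edge on one side and at the end
    of the last one on the other; closedness identifies the two vertices. *)
Lemma gog_closedE Q :
  gog_closed Q = (Q != [::]) && path.cycle (@gog_step gT X) Q.
Proof.
case: Q => // x Q; rewrite /gog_closed /= rcons_path /gog_step.
rewrite [Defs.root x.2 == _]eq_sym.
case: (boolP (_ == Defs.root x.2)) => [/eqP ->|_]; last by rewrite !andbF.
by rewrite andbT andbC.
Qed.

Lemma gog_reducedE Q :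
  gog_reduced Q = (Q != [::]) && path.cycle (@letter_rel gT X) Q.
Proof.
rewrite /gog_reduced gog_closedE -andbA; congr (_ && _).
case: Q => // x Q; rewrite /= -path_relI; apply: eq_path => y z.
by rewrite /letter_rel /turn /gog_step /= andbA.
Qed.

Lemma gog_path_catl P Q : P != [::] -> gog_path (P ++ Q) -> gog_path P.
Proof.
case: P => // x P _ /= /andP[-> /=].
by rewrite cat_path => /andP[].
Qed.

(** If a closed path is a power of a word, this word is a prefix of it and so a path: both notions
    exclude the same powers. *)
Lemma gog_primitiveE Q : gog_primitive Q <->
  primitive_word Q /\ path.cycle (@letter_rel gT X) Q.
Proof.
rewrite /gog_primitive gog_reducedE; split.
  move=> [/andP[Q0 Qcyc] Qprim]; split=> //; split=> // P k k2 QP.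
  apply: (Qprim P k) => //.
  have P0 : P != [::].
    by apply: contra Q0 => /eqP P0; rewrite -size_eq0 QP P0 size_word_pow muln0.
  have : gog_closed Q.
    by have := gog_reducedE Q; rewrite Q0 Qcyc /= => /andP[].
  rewrite QP; case: k k2 {QP} => // k _.
  by rewrite word_powS => /andP[/(gog_path_catl P0)].
by move=> [[Q0 Qprim] Qcyc]; rewrite Q0 Qcyc; split=> // P k _; exact: Qprim.
Qed.

Lemma rot_iter_rot1 (T : Type) i (w : seq T) :
  exists n, rot i w = iter n (rot 1) w.
Proof.
have [lei|/ltnW lti] := leqP i (size w).
  by exists i; elim: i lei => [|i IHi] lti; rewrite ?rot0 // rotS // IHi // ltnW.
by exists 0%N; rewrite rot_oversize.
Qed.

Lemma iter_rot1_rot (T : Type) n (w : seq T) :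
  exists i, iter n (rot 1) w = rot i w.
Proof.
elim: n => [|n [i IHn]]; first by exists 0%N; rewrite rot0.
have [lti|lei] := ltnP i (size w); first by exists i.+1; rewrite rotS // -IHn.
(* Here [rot i] is already the identity, so one more step is [rot 1]. *)
by exists 1%N; rewrite iterS IHn (rot_oversize lei).
Qed.

Lemma cyclic_shiftP (T : Type) (P Q : seq T) :
  cyclic_shift P Q <-> exists n, Q = iter n (rot 1) P.
Proof.
split=> [[i ->]|[n ->]]; first exact: rot_iter_rot1.
by have [i ->] := iter_rot1_rot n P; exists i.
Qed.

Lemma cyclic_shift_sym (T : eqType) (P Q : seq T) :
  cyclic_shift P Q -> cyclic_shift Q P.
Proof.
move=> /cyclic_shiftP[n ->]; have [m mK] := iter_rot1K n P.
by apply/cyclic_shiftP; exists m.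
Qed.

Lemma cyclic_shift_trans (T : Type) (P Q W : seq T) :
  cyclic_shift P Q -> cyclic_shift Q W -> cyclic_shift P W.
Proof.
move=> /cyclic_shiftP[n ->] /cyclic_shiftP[m ->]; apply/cyclic_shiftP.
by exists (m + n)%N; rewrite iterD.
Qed.

Lemma cyclic_class_shift P Q :
  cyclic_shift P Q -> cyclic_class P = cyclic_class Q.
Proof.
move=> PQ; apply/seteqP; split=> W [cW sW]; split=> //.
  exact: cyclic_shift_trans (cyclic_shift_sym PQ) sW.
exact: cyclic_shift_trans sW.
Qed.

(** The same choice as in [prime_factor], so that Euler factors match by conversion. *)
Definition prime_rep (q : set_type (@Defs.primes gT X)) : word X :=
  xget [::] (val q).

Lemma prime_rep_spec (q : set_type (@Defs.primes gT X)) :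
  gog_primitive (prime_rep q) /\ val q = cyclic_class (prime_rep q).
Proof.
have : Defs.primes (val q) by have := valP q; rewrite inE.
rewrite /prime_rep => -[Q Qprim qE]; rewrite qE.
have Qcl : gog_closed Q by case: Qprim => /andP[].
have QQ : cyclic_class Q Q by split=> //; exists 0%N; rewrite rot0.
have [cl sh] := xgetI [::] QQ; split; last exact: cyclic_class_shift.
have /gog_primitiveE[Qp Qc] := Qprim; apply/gog_primitiveE.
have /cyclic_shiftP[n ->] := sh.
by rewrite cycle_iter_rot1; split=> //; exact: primitive_iter_rot1.
Qed.

Local Open Scope fset_scope.

(** There are finitely many words of length at most [n]; [insub] discards the classes that are not
    primes. *)
Lemma primes_up_to n : exists A : {fset set_type (@Defs.primes gT X)},
  forall q, (size (prime_rep q) <= n)%N -> q \in A.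
Proof.
pose L : seq (set_type (@Defs.primes gT X)) := pmap insub
  [seq @cyclic_class gT X Q
    | Q <- flatten [seq words (gT * half_edge (underlying X))%type k | k <- iota 0 n.+1]].
exists [fset q in L] => q len.
rewrite !inE mem_pmap_sub; apply/mapP; exists (prime_rep q).
  apply/flatten_mapP; exists (size (prime_rep q)).
    by rewrite mem_iota add0n ltnS.
  by rewrite mem_words.
by have [] := prime_rep_spec q.
Qed.

Lemma primes_cycle_reps n (A : {fset set_type (@Defs.primes gT X)}) :
  (forall q, (size (prime_rep q) <= n)%N -> q \in A) ->
  cycle_reps (@letter_rel gT X) n [seq prime_rep q | q <- A].
Proof.
move=> An; split.
- rewrite map_inj_uniq ?fset_uniq // => q q' qq'; apply: val_inj.
  have [_ ->] := prime_rep_spec q; have [_ ->] := prime_rep_spec q'.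
  by rewrite qq'.
- move=> _ /mapP[q _ ->]; apply/gog_primitiveE.
  by have [] := prime_rep_spec q.
- move=> _ _ m /mapP[q _ ->] /mapP[q' _ ->] qq'; congr prime_rep.
  apply: val_inj; have [_ ->] := prime_rep_spec q.
  have [_ ->] := prime_rep_spec q'; apply: cyclic_class_shift.
  by apply/cyclic_shiftP; exists m.
move=> P Pprim Pcyc leP.
have Pgog : gog_primitive P by apply/gog_primitiveE.
have PP : Defs.primes (cyclic_class P) by exists P.
pose q : set_type (@Defs.primes gT X) := SigSub (mem_set PP).
have Pcl : gog_closed P by case: Pgog => /andP[].
have [_ /cyclic_shiftP[m mE]] : cyclic_class P (prime_rep q).
  have [[/andP[cl _] _] E] := prime_rep_spec q.
  have -> : cyclic_class P = val q by [].
  by rewrite E; split=> //; exists 0%N; rewrite rot0.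
exists m; rewrite -mE map_f // An //.
by rewrite mE size_iter_rot1.
Qed.

End PrimeReps.

(** * Convergence along finite sets of primes *)

(** Below the inverse of a bound on all eigenvalues no factor [1 - z u] vanishes. This allows the
    limit of the products to be inverted. *)
Lemma det_1B_neq0 (C : numClosedFieldType) n (M : 'M[C]_n) :
  exists2 r : C, 0 < r & forall u, `|u| < r -> \det (1%:M - u *: M) != 0.
Proof.
have [s [_ _ _ dets _]] := eigen_seq_exists M.
have S0 : 0 < 1 + \sum_(z <- s) `|z| by rewrite ltr_pwDl // sumr_ge0.
exists (1 + \sum_(z <- s) `|z|)^-1 => [|u ltu]; first by rewrite invr_gt0.
rewrite dets prodf_seq_neq0; apply/allP => z sz /=.
rewrite subr_eq0; apply/eqP => /(congr1 Num.norm); rewrite normr1 normrM => zu1.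
have : `|z| * `|u| < 1.
  apply: (@le_lt_trans _ _ ((1 + \sum_(z <- s) `|z|) * `|u|)).
    rewrite ler_wpM2r // (big_rem z sz) /= addrCA lerDl addr_ge0 //.
    by rewrite sumr_ge0.
  by rewrite mulrC -ltr_pdivlMr // mul1r.
by rewrite -zu1 ltxx.
Qed.

(** A positive complex number is real, so the archimedean property of [R] applies. *)
Lemma complex_upper_nthroot (R : realType) (K eps : Cplx R) :
  0 < eps -> exists n, `|K| < 2 ^+ n * eps.
Proof.
case: eps => e e'; rewrite ltcE /= => /andP[/eqP -> e_gt0].
have := normr_ge0 K; case: `|K| => k k'; rewrite lecE /= => /andP[/eqP -> _].
have := @Num.Theory.upper_nthrootP R (k / e) (Num.bound (k / e)) (leqnn _).
rewrite ltr_pdivrMr // => lt_k; exists (Num.bound (k / e)).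
have -> : 2 ^+ Num.bound (k / e) * (e +i* 0)%C =
    (2 ^+ Num.bound (k / e) * e)%:C%C :> Cplx R.
  by rewrite rmorphM rmorphXn /= rmorph_nat.
by rewrite ltcR.
Qed.

Lemma Cplx_nbhs0_lt (R : realType) (r : Cplx R) :
  0 < r -> (\forall u \near (0 : Cplx R), `|u| < r)%classic.
Proof. exact: nbhs0_lt. Qed.

Lemma cvg_prime_products (R : realType) (gT : finGroupType) (d : nat)
    (rho : mx_representation (Cplx R) [set: gT]%SET d)
    (X : graph_of_groups gT) (F : half_edge (underlying X) -> gT) :
  (\forall u \near (0 : Cplx R),
     (fun A : {fset set_type (@Defs.primes gT X)} =>
        \prod_(q <- A) prime_factor rho F u (val q)) @ totally -->
     walk_det rho (@letter_rel gT X) (letter_weight F) u)%classic.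
Proof.
have [r [K [r_gt0 close]]] :=
  euler_estimate rho (@letter_rel gT X) (letter_weight F).
have r2 : 0 < r / 2 by rewrite divr_gt0.
near=> u.
have ler : `|u| <= r / 2 by apply: ltW; near: u; exact: Cplx_nbhs0_lt.
have FF := @totally_filter (set_type (@Defs.primes gT X)).
apply/cvgrPdist_lt => eps eps_gt0.
have [n ltn] := complex_upper_nthroot K eps_gt0.
have [A0 A0P] := primes_up_to X n.
exists A0 => // A /= A0A.
have reps : cycle_reps (@letter_rel gT X) n [seq prime_rep q | q <- A].
  apply: primes_cycle_reps => q leq; apply: (fsubsetP A0A).
  exact: A0P.
have := close n _ u reps ler; rewrite big_map => le_close.
rewrite distrC.
have K_ge0 : 0 <= 2^-1 ^+ n * K by apply: le_trans le_close.
apply: le_lt_trans le_close _; rewrite -(ger0_norm K_ge0) normrM.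
rewrite ger0_norm ?exprn_ge0 ?invr_ge0 // exprVn mulrC ltr_pdivrMr ?exprn_gt0 //.
by rewrite mulrC.
Unshelve. all: by end_near. Qed.

(** * Frobenius elements of opposite half-edges and the determinant formula *)

Lemma frob_bar (gT : finGroupType) (Y : graph) (a : graph_action gT Y)
    (c : lift_data a) (h : half_edge (quotient_graph a)) :
  edge_free a -> (frob c h * frob c (bar h))%g = 1%g.
Proof.
move=> free; have [leg|nleg] := boolP (is_leg h).
  rewrite (eqP leg); have [leg'|nleg'] := boolP (is_leg (hlift c h)).
    by have [_ ->] := lift_leg_leg leg leg'; rewrite mulg1.
  have [_ Fh] := lift_leg_edge leg nleg'.
  (* Applying [F(h)] twice reverses the lifted edge twice, so [F(h)^2] fixes a half-edge and is 1 by
     freeness. *)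
  apply: (free _ (hlift c h)); rewrite /lact invMg actM.
  rewrite -/(lact _ _ _) -/(lact _ _ _) Fh -bar_lact Fh.
  exact: barK.
have [ht|hnt] := boolP (h \in tree c).
  have [_ _ ->] := lift_tree ht.
  have [bt _ _ _] := tree_spanning c.
  by have [_ _ ->] := lift_tree (bt _ ht); rewrite mulg1.
have nleg_bar : ~~ is_leg (bar h).
  by apply: contra nleg => /eqP; rewrite barK /is_leg => E; rewrite -E.
have hnt_bar : bar h \notin tree c.
  have [bt _ _ _] := tree_spanning c.
  by apply: contra hnt => /bt; rewrite barK.
(* Exactly one of [h] and [bar h] is oriented, and [lift_edge] is used for that one. *)
have [ho|hno] := boolP (h \in orientation c).
  by have [_ _ -> _] := lift_edge nleg hnt ho; rewrite mulgV.
have hob : bar h \in orientation c.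
  by move: hno; rewrite (orientationP nleg hnt) negbK.
have [_ _ + _] := lift_edge nleg_bar hnt_bar hob.
by rewrite barK => ->; rewrite mulVg.
Qed.

Unset Implicit Arguments.
Set Strict Implicit.
Set Printing Implicit Defensive.

Theorem theorem4p17 (R : realType) (gT : finGroupType) (Y : graph)
    (a : graph_action gT Y) (c : lift_data a) (d : nat)
    (rho : mx_representation (Cplx R) [set: gT]%SET d) :
  connected_graph Y -> edge_free a ->
  (\forall u \near (0 : Cplx R),
     L_converges rho c u /\
     (L_function rho c u)^-1 =
       (1 - u ^+ 2) ^ ((betti1 (quotient_graph a) - 1) * d%:Z)
       * (1 + u) ^+ leg_mult rho c 1
       * (1 - u) ^+ leg_mult rho c (- 1)
       * \det (1%:M - u *: (C_mx rho c *m A_mx rho c)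
               + u ^+ 2 *: (C_mx rho c *m Q_mx R d a - 1%:M)))%classic.
Proof.
move=> _ free; pose X := quotient_gog c.
have [r r_gt0 det_neq0] := det_1B_neq0 (C := Cplx R)
  (walk_mx (@letter_rel gT X) (fun x => rho (letter_weight (X := X) (frob c) x))).
near=> u.
have u_lt1 : `|u| < 1 by near: u; exact: Cplx_nbhs0_lt.
have u_ltr : `|u| < r by near: u; exact: Cplx_nbhs0_lt.
have D_neq0 := det_neq0 u u_ltr.
have FF := @totally_filter (set_type (@Defs.primes gT X)).
have cvg_prod : ((fun A : {fset set_type (@Defs.primes gT X)} =>
    \prod_(q <- A) prime_factor rho (X := X) (frob c) u (val q)) @ totally -->
    walk_det rho (@letter_rel gT X) (letter_weight (X := X) (frob c)) u)%classic.
  by near: u; exact: cvg_prime_products.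
have cvgL : (euler_product rho (X := X) (frob c) u @ totally -->
    (walk_det rho (@letter_rel gT X) (letter_weight (X := X) (frob c)) u)^-1)%classic.
  have -> : euler_product rho (X := X) (frob c) u =
    (fun A => (\prod_(q <- A) prime_factor rho (X := X) (frob c) u (val q))^-1).
    by apply/funext => A; rewrite /euler_product prodfV.
  exact: cvgV.
split; first exact: (cvgP _ cvgL).
rewrite /L_function (cvg_lim _ cvgL) // invrK.
have c_neq0 : 1 - u ^+ 2 != 0.
  rewrite subr_eq0; apply/eqP => /(congr1 Num.norm); rewrite normr1 normrX => u1.
  by have := @exprn_ilt1 _ 2 _ (normr_ge0 u) u_lt1; rewrite -u1 ltxx.
exact: (bass_formula rho (X := X) (F := frob c) (fun h => frob_bar c h free) c_neq0).
Unshelve. all: by end_near. Qed.
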